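(* Pattern-based definitions and their proof rules add no new power to the logic $\mathcal{G}$ described below. Precisely: let $p$ be a predicate whose pattern-based clauses are $\{\forall\vec x_i.(\nabla\vec z_i.\,p\,\vec t_i)\triangleq B_i\,p\,\vec x_i\}_{i\in 1..n}$, and interpret $p$ in $\mathcal{G}$ by the single translated clause $\forall\vec y.\ p\,\vec y\triangleq\bigvee_{i\in 1..n}\exists\vec x_i.\big(((\lambda\vec z_i.\,p'\,\vec t_i)\unrhd p'\,\vec y)\land B_i\,p\,\vec x_i\big)$, where $p'$ is a new constant with the same argument types as $p$ and the variables $\vec y$ do not occur in any $\vec t_i$. Then the rules $\mathit{def}\mathcal{L}^p$ and $\mathit{def}\mathcal{R}^p$ below are admissible in $\mathcal{G}$ with this translated definition: whenever all premises of an instance of either rule are provable, its conclusion is provable. $\mathit{def}\mathcal{R}^p$: from $\Sigma:\Gamma\vdash(B_i\,p\,\vec x_i)[\theta]$ infer $\Sigma:\Gamma\vdash p\,\vec s$, for any clause $i$ and any substitution $\theta$ such that $\mathrm{range}(\theta)\cap\Sigma=\emptyset$ and $(\lambda\vec z_i.\,p\,\vec t_i)[\theta]\unrhd p\,\vec s$ holds. $\mathit{def}\mathcal{L}^p$: from the premises $\{\Sigma\theta:\Gamma\langle\theta\rangle,(B_i\,p\,\vec x_i)\langle\theta\rangle\vdash C\langle\theta\rangle \mid i\in 1..n,\ \theta$ a solution to $(\lambda\vec z_i.\,p\,\vec t_i)\unrhd p\,\vec s\}$ infer $\Sigma:\Gamma,p\,\vec s\vdash C$.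
   Context: A pattern-based definition is a finite collection of clauses $\forall\vec x.(\nabla\vec z.\,p\,\vec t)\triangleq B\,p\,\vec x$ where $\vec t$ are terms containing no nominal constants, $p\,\vec t$ has type $o$, and $B$ contains no occurrences of $p$, $\vec x$ or nominal constants with $B\,p\,\vec t$ of type $o$; several clauses may define the same $p$; they must be stratified: there is a level assignment with $\mathrm{lvl}(B\,(\lambda\vec x.\top)\,\vec x)<\mathrm{lvl}(p)$ for every clause (levels as below). THE LOGIC $\mathcal{G}$. Terms are simply typed (Church) $\lambda$-terms over constants and variables, identified up to $\alpha\beta\eta$-conversion. There is a type $o$ of formulas; $o$ does not occur in argument types of non-logical constants nor in types of eigenvariables. Logical constants: $\top,\bot,\land,\lor,\supset$, and for each type $\tau$ not containing $o$, $\forall_\tau,\exists_\tau,\nabla_\tau$ of type $(\tau\to o)\to o$. Constants are partitioned into nominal constants $\mathcal{C}$ (infinitely many at each type at which $\nabla$ is allowed) and ordinary constants $\mathcal{K}$. $\mathrm{supp}(t)$ is the set of nominal constants in $t$. A permutation $\pi$ is a type-preserving bijection of $\mathcal{C}$ moving finitely many elements, acting on terms by renaming nominal constants; $B\approx B'$ iff $B$ $\lambda$-converts to $\pi.B'$ for some $\pi$. Substitutions: type-preserving maps from variables to terms, identity almost everywhere; $\mathrm{supp}(\theta)$ = nominal constants in the range. $B[\theta]$ is ordinary capture-avoiding application; $B\langle\theta\rangle=(\pi.B)[\theta]$ for a permutation $\pi$ sending $\mathrm{supp}(B)$ outside $\mathrm{supp}(\theta)$; $\Gamma\langle\theta\rangle=\{B\langle\theta\rangle\mid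 B\in\Gamma\}$. $\Sigma\theta$ is $\Sigma$ with the domain variables of $\theta$ removed and all free variables of the range terms added. Nominal abstraction: for $s:\tau_1\to\cdots\to\tau_n\to\tau$ and $t:\tau$, $s\unrhd t$ is a formula; ''$s\unrhd t$ holds'' iff $s$ $\lambda$-converts to $\lambda c_1\dots\lambda c_n.t$ (the $c_i$ distinct nominal constants abstracted out of $t$ by replacing them with fresh bound variables). $\theta$ is a solution to $s\unrhd t$ iff $(s\unrhd t)\langle\theta\rangle$ holds. Definitions of $\mathcal{G}$: a fixed finite set of clauses $\forall\vec x.\,p\,\vec x \triangleq B\,p\,\vec x$ (or $\stackrel{\mu}{=}$, inductive, or $\stackrel{\nu}{=}$, co-inductive), at most one per predicate constant $p$, where $B$ contains no $p$, no $\vec x$ and no nominal constants, and stratified: there are levels $\mathrm{lvl}(p)\in\mathbb{N}$, extended to $\lambda$-normal formulas by $\mathrm{lvl}(p\,\vec t)=\mathrm{lvl}(p)$, $\mathrm{lvl}(\top)=\mathrm{lvl}(\bot)=\mathrm{lvl}(s\unrhd t)=0$, $\mathrm{lvl}(B\land C)=\mathrm{lvl}(B\lor C)=\max$, $\mathrm{lvl}(B\supset C)=\max(\mathrm{lvl}(B)+1,\mathrm{lvl}(C))$, quantifiers transparent, with $\mathrm{lvl}(B\,(\lambda\vec x.\top)\,\vec x)<\mathrm{lvl}(p)$ for every clause. Sequents $\Sigma:\Gamma\vdash C$: $\Sigma$ a set of eigenvariables containing the free variables of $\Gamma,C$; $\Gamma$ a multiset. Rules: id: $\Sigma:\Gamma,B\vdash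 B'$ if $B\approx B'$. cut: from $\Sigma:\Gamma\vdash B$ and $\Sigma:B,\Delta\vdash C$ infer $\Sigma:\Gamma,\Delta\vdash C$. $c\mathcal{L}$: from $\Sigma:\Gamma,B,B\vdash C$ infer $\Sigma:\Gamma,B\vdash C$. $\bot\mathcal{L}$: $\Sigma:\Gamma,\bot\vdash C$. $\top\mathcal{R}$: $\Sigma:\Gamma\vdash\top$. $\lor\mathcal{L}$: from $\Sigma:\Gamma,B\vdash C$ and $\Sigma:\Gamma,D\vdash C$ infer $\Sigma:\Gamma,B\lor D\vdash C$. $\lor\mathcal{R}$: from $\Sigma:\Gamma\vdash B_i$ infer $\Sigma:\Gamma\vdash B_1\lor B_2$. $\land\mathcal{L}$: from $\Sigma:\Gamma,B_i\vdash C$ infer $\Sigma:\Gamma,B_1\land B_2\vdash C$. $\land\mathcal{R}$: from $\Sigma:\Gamma\vdash B$ and $\Sigma:\Gamma\vdash C$ infer $\Sigma:\Gamma\vdash B\land C$. $\supset\mathcal{L}$: from $\Sigma:\Gamma\vdash B$ and $\Sigma:\Gamma,D\vdash C$ infer $\Sigma:\Gamma,B\supset D\vdash C$. $\supset\mathcal{R}$: from $\Sigma:\Gamma,B\vdash C$ infer $\Sigma:\Gamma\vdash B\supset C$. $\forall\mathcal{L}$ / $\exists\mathcal{R}$: from $\Sigma:\Gamma,B[t/x]\vdash C$ (resp. $\Sigma:\Gamma\vdash B[t/x]$) infer $\Sigma:\Gamma,\forall_\tau x.B\vdash C$ (resp. $\Sigma:\Gamma\vdash\exists_\tau x.B$),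 where $t$ is a well-typed term of type $\tau$ built from $\Sigma$ and $\mathcal{K}\cup\mathcal{C}$. $\forall\mathcal{R}$ / $\exists\mathcal{L}$: from $\Sigma,h:\Gamma\vdash B[h\,\vec c/x]$ (resp. $\Sigma,h:\Gamma,B[h\,\vec c/x]\vdash C$) infer $\Sigma:\Gamma\vdash\forall x.B$ (resp. $\Sigma:\Gamma,\exists x.B\vdash C$), where $h\notin\Sigma$ is a fresh variable of suitable type and $\vec c$ lists $\mathrm{supp}(B)$. $\nabla\mathcal{L}$ / $\nabla\mathcal{R}$: from $\Sigma:\Gamma,B[a/x]\vdash C$ (resp. $\Sigma:\Gamma\vdash B[a/x]$) infer $\Sigma:\Gamma,\nabla x.B\vdash C$ (resp. $\Sigma:\Gamma\vdash\nabla x.B$), $a$ a nominal constant not in $\mathrm{supp}(B)$. $\unrhd\mathcal{L}$: from the (possibly infinite) family $\{\Sigma\theta:\Gamma\langle\theta\rangle\vdash C\langle\theta\rangle\mid\theta$ a solution to $s\unrhd t\}$ infer $\Sigma:\Gamma,s\unrhd t\vdash C$. $\unrhd\mathcal{R}$: $\Sigma:\Gamma\vdash s\unrhd t$ provided $s\unrhd t$ holds. $\mathit{def}\mathcal{L}$ / $\mathit{def}\mathcal{R}$ (for $p$ with clause body $B$ of any of the three kinds): from $\Sigma:\Gamma,B\,p\,\vec t\vdash C$ infer $\Sigma:\Gamma,p\,\vec t\vdash C$; from $\Sigma:\Gamma\vdash B\,p\,\vec t$ infer $\Sigma:\Gamma\vdash p\,\vec t$. $\mathcal{IL}$: if $p$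 has clause $\forall\vec x.p\,\vec x\stackrel{\mu}{=}B\,p\,\vec x$ and $S$ is a term of the type of $p$ without nominal constants, from $\vec x:B\,S\,\vec x\vdash S\,\vec x$ and $\Sigma:\Gamma,S\,\vec t\vdash C$ infer $\Sigma:\Gamma,p\,\vec t\vdash C$. $\mathcal{CIR}$: if $p$ has clause $\forall\vec x.p\,\vec x\stackrel{\nu}{=}B\,p\,\vec x$ and $S$ as before, from $\Sigma:\Gamma\vdash S\,\vec t$ and $\vec x:S\,\vec x\vdash B\,S\,\vec x$ infer $\Sigma:\Gamma\vdash p\,\vec t$. Derivations are well-founded, possibly infinitely branching trees of rule instances.
   Formalization: In defL^p the clause variables x_i are replaced by h_i c, with h_i fresh and c listing supp(p s), and premises have signature (Σ,h)θ; with unraised x_i the rule is unsound when s has nominal constants (for p x ≜ ⊤ it yields p a ⊢ ⊥ from no premises). *)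

(* Defs.v *)
From Stdlib Require Export List Permutation PeanoNat.
Export ListNotations.
Set Implicit Arguments.
Unset Strict Implicit.
Unset Printing Implicit Defensive.

Inductive ty (b : Type) : Type :=
| Base : b -> ty b
| Prp : ty b
| Arr : ty b -> ty b -> ty b.
Arguments Prp {b}.

Definition ty_eq_dec (b : Type) (b_eq_dec : forall x y : b, {x = y} + {x <> y})
  (s t : ty b) : {s = t} + {s <> t}.
Proof. decide equality. Defined.

Fixpoint o_free {b : Type} (t : ty b) : bool :=
  match t with
  | Base _ => true
  | Prp => false
  | Arr s u => andb (o_free s) (o_free u)
  end.

Definition arrs {b : Type} (ts : list (ty b)) (t : ty b) : ty b :=
  fold_right (@Arr b) t ts.

(* [None] stands for the type of formulas. *)
Definition target {b : Type} (r : option b) : ty b :=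
  match r with Some x => Base x | None => Prp end.

(* [const ts r] is the set of ordinary constants of type
   [arrs ts (target r)]; those with [r = None] are the predicate constants. *)
Record signature : Type := Signature {
  base : Type;
  base_eq_dec : forall x y : base, {x = y} + {x <> y};
  const : list (ty base) -> option base -> Type;
  const_o_free : forall ts r, const ts r -> forallb o_free ts = true
}.

Definition typ (S : signature) : Type := ty (base S).

(* Names of a given type, which must not contain the type of formulas.  They
   serve both for eigenvariables and for nominal constants. *)
Record name {S : signature} (t : typ S) : Type := Name {
  name_index : nat;
  name_o_free : o_free t = true
}.

Inductive logical {S : signature} : typ S -> Type :=
| Top : logical Prp
| Bot : logical Prp
| And : logical (Arr Prp (Arr Prp Prp))
| Or : logical (Arr Prp (Arr Prp Prp))
| Imp : logical (Arr Prp (Arr Prp Prp))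
| All : forall t, o_free t = true -> logical (Arr (Arr t Prp) Prp)
| Ex : forall t, o_free t = true -> logical (Arr (Arr t Prp) Prp)
| Nabla : forall t, o_free t = true -> logical (Arr (Arr t Prp) Prp)
| NAbs : forall ts t, logical (Arr (arrs ts t) (Arr t Prp)).

Inductive member {A : Type} (a : A) : list A -> Type :=
| MZ : forall l, member a (a :: l)
| MS : forall b l, member a l -> member a (b :: l).
Arguments MZ {A a l}.
Arguments MS {A a b l} _.

Inductive hlist {A : Type} (F : A -> Type) : list A -> Type :=
| hnil : hlist F []
| hcons : forall a l, F a -> hlist F l -> hlist F (a :: l).
Arguments hnil {A F}.
Arguments hcons {A F a l} _ _.

Fixpoint hmap {A : Type} {F G : A -> Type} (f : forall a, F a -> G a)
  {l : list A} (h : hlist F l) : hlist G l :=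
  match h with
  | hnil => hnil
  | hcons x h' => hcons (f _ x) (hmap f h')
  end.

Fixpoint hto_list {A : Type} {F : A -> Type} {l : list A} (h : hlist F l) :
  list {a : A & F a} :=
  match h with
  | hnil => []
  | hcons x h' => existT F _ x :: hto_list h'
  end.

(* Church-typed terms; de Bruijn indices are used for the lambda-bound
   variables only, listed with their types in the first index. *)
Inductive term {S : signature} : list (typ S) -> typ S -> Type :=
| Bvar : forall G t, member t G -> term G t
| Fvar : forall G t, name t -> term G t
| Nom : forall G t, name t -> term G t
| Cst : forall G ts r, const ts r -> term G (arrs ts (target r))
| Log : forall G t, logical t -> term G t
| Lam : forall G t u, term (t :: G) u -> term G (Arr t u)
| App : forall G t u, term G (Arr t u) -> term G t -> term G u.
Arguments Bvar {S G t} _.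
Arguments Fvar {S G t} _.
Arguments Nom {S G t} _.
Arguments Cst {S G ts r} _.
Arguments Log {S G t} _.
Arguments Lam {S G t u} _.
Arguments App {S G t u} _ _.

Definition form (S : signature) : Type := @term S [] Prp.

Section Syntax.
Context {S : signature}.
Implicit Types (G D : list (typ S)) (t u : typ S).

Definition ren_lift {G D u} (f : forall t, member t G -> member t D) :
  forall t, member t (u :: G) -> member t (u :: D) :=
  fun t m =>
    match m in member _ l
      return match l with
             | [] => unit
             | v :: l' => (member t l' -> member t D) -> member t (v :: D)
             end with
    | MZ => fun _ => MZ
    | MS m' => fun g => MS (g m')
    end (f t).

Fixpoint ren {G t} (e : term G t) :
  forall D, (forall t, member t G -> member t D) -> term D t :=
  match e in term G0 t0
    return forall D, (forall t, member t G0 -> member t D) -> term D t0 with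
  | Bvar m => fun D f => Bvar (f _ m)
  | Fvar x => fun D f => Fvar x
  | Nom a => fun D f => Nom a
  | Cst k => fun D f => Cst k
  | Log k => fun D f => Log k
  | Lam e' => fun D f => Lam (ren e' (ren_lift f))
  | App e1 e2 => fun D f => App (ren e1 f) (ren e2 f)
  end.

Definition shift {G t u} (e : term G t) : term (u :: G) t :=
  ren e (fun _ m => MS m).

Definition no_member {t : typ S} {A : Type} (m : member t []) : A :=
  match m in member _ l return match l with [] => A | _ :: _ => unit end with
  | MZ => tt
  | MS _ => tt
  end.

Definition weaken {G t} (e : term [] t) : term G t :=
  ren e (fun _ m => no_member m).

Definition sub_cons {G D u} (e : term D u) (f : forall t, member t G -> term D t) :
  forall t, member t (u :: G) -> term D t :=
  fun t m =>
    match m in member _ l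
      return match l with
             | [] => unit
             | v :: l' => term D v -> (member t l' -> term D t) -> term D t
             end with
    | MZ => fun e _ => e
    | MS m' => fun _ g => g m'
    end e (f t).

Definition sub_lift {G D u} (f : forall t, member t G -> term D t) :
  forall t, member t (u :: G) -> term (u :: D) t :=
  sub_cons (Bvar MZ) (fun t m => shift (f t m)).

Fixpoint bsubst {G t} (e : term G t) :
  forall D, (forall t, member t G -> term D t) -> term D t :=
  match e in term G0 t0
    return forall D, (forall t, member t G0 -> term D t) -> term D t0 with
  | Bvar m => fun D f => f _ m
  | Fvar x => fun D f => Fvar x
  | Nom a => fun D f => Nom a
  | Cst k => fun D f => Cst k
  | Log k => fun D f => Log k
  | Lam e' => fun D f => Lam (bsubst e' (sub_lift f))
  | App e1 e2 => fun D f => App (bsubst e1 f) (bsubst e2 f)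
  end.

(* beta-eta-conversion.  Terms are identified up to [conv] (alpha-conversion
   being equality here), so every notion below is invariant under it. *)
Inductive conv : forall G t, term G t -> term G t -> Prop :=
| conv_beta : forall G t u (e : term (t :: G) u) (e' : term G t),
    conv (App (Lam e) e') (bsubst e (sub_cons e' (fun _ m => Bvar m)))
| conv_eta : forall G t u (e : term G (Arr t u)),
    conv (Lam (App (shift e) (Bvar MZ))) e
| conv_lam : forall G t u (e e' : term (t :: G) u),
    conv e e' -> conv (Lam e) (Lam e')
| conv_app : forall G t u (e1 e1' : term G (Arr t u)) (e2 e2' : term G t),
    conv e1 e1' -> conv e2 e2' -> conv (App e1 e2) (App e1' e2')
| conv_refl : forall G t (e : term G t), conv e e
| conv_sym : forall G t (e e' : term G t), conv e e' -> conv e' e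
| conv_trans : forall G t (e1 e2 e3 : term G t),
    conv e1 e2 -> conv e2 e3 -> conv e1 e3.

Fixpoint apps {G ts t} (e : term G (arrs ts t)) (es : hlist (term G) ts) : term G t :=
  match es in hlist _ ts0 return term G (arrs ts0 t) -> term G t with
  | hnil => fun e => e
  | hcons e1 es' => fun e => apps (App e e1) es'
  end e.

Fixpoint lams {ts G t} : term (rev_append ts G) t -> term G (arrs ts t) :=
  match ts return term (rev_append ts G) t -> term G (arrs ts t) with
  | [] => fun e => e
  | u :: ts' => fun e => Lam (@lams ts' (u :: G) t e)
  end.

Fixpoint member_under {ts G t} : member t G -> member t (rev_append ts G) :=
  match ts return member t G -> member t (rev_append ts G) with
  | [] => fun m => m
  | u :: ts' => fun m => @member_under ts' (u :: G) t (MS m)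
  end.

(* The variables bound by [lams ts], first one first. *)
Fixpoint bound_vars (ts : list (typ S)) (G : list (typ S)) :
  hlist (term (rev_append ts G)) ts :=
  match ts return hlist (term (rev_append ts G)) ts with
  | [] => hnil
  | u :: ts' => hcons (Bvar (member_under MZ)) (bound_vars ts' (u :: G))
  end.

Definition fvars {ts} (xs : hlist name ts) : hlist (@term S []) ts :=
  hmap (fun _ x => Fvar x) xs.
Definition noms {ts} (cs : hlist name ts) : hlist (@term S []) ts :=
  hmap (fun _ a => Nom a) cs.

Inductive symbol : Type :=
| SVar : forall t, name t -> symbol
| SNom : forall t, name t -> symbol
| SCst : forall ts r, @const S ts r -> symbol.

Fixpoint written (s : symbol) {G t} (e : term G t) : Prop :=
  match e with
  | Bvar _ => False
  | Fvar x => s = SVar x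
  | Nom a => s = SNom a
  | Cst k => s = SCst k
  | Log _ => False
  | Lam e' => written s e'
  | App e1 e2 => written s e1 \/ written s e2
  end.

(* Occurrence in the conversion class: [s] is written in every
   representative (equivalently, in the normal form). *)
Definition occurs (s : symbol) {G t} (e : term G t) : Prop :=
  forall e', conv e e' -> written s e'.

Definition fv {G t} (e : term G t) (u : typ S) (x : name u) : Prop := occurs (SVar x) e.
Definition supp {G t} (e : term G t) (u : typ S) (a : name u) : Prop := occurs (SNom a) e.

Definition closed {G t} (e : term G t) : Prop := forall u (x : name u), ~ fv e x.
Definition nominal_free {G t} (e : term G t) : Prop := forall u (a : name u), ~ supp e a.

Definition lists_supp {ts} (cs : hlist name ts) {G t} (e : term G t) : Prop :=
  NoDup (hto_list cs) /\
  forall u (a : name u), supp e a <-> In (existT name u a) (hto_list cs).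

Definition finite (P : forall t : typ S, name t -> Prop) : Prop :=
  exists l : list {t : typ S & name t},
    forall t (x : name t), P t x -> In (existT name t x) l.

Record perm : Type := Perm {
  perm_fun :> forall t : typ S, name t -> name t;
  perm_inv : forall t : typ S, name t -> name t;
  perm_funK : forall t (a : name t), perm_inv (perm_fun a) = a;
  perm_invK : forall t (a : name t), perm_fun (perm_inv a) = a;
  perm_finite : finite (fun t a => perm_fun a <> a)
}.

Fixpoint pact (pi : perm) {G t} (e : term G t) : term G t :=
  match e with
  | Bvar m => Bvar m
  | Fvar x => Fvar x
  | Nom a => Nom (pi _ a)
  | Cst k => Cst k
  | Log k => Log k
  | Lam e' => Lam (pact pi e')
  | App e1 e2 => App (pact pi e1) (pact pi e2)
  end.

Definition equivariant (A B : form S) : Prop := exists pi : perm, conv A (pact pi B).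

Record subst : Type := Subst {
  subst_fun :> forall t : typ S, name t -> @term S [] t;
  subst_finite : finite (fun t x => ~ conv (subst_fun x) (Fvar x))
}.

Definition dom (theta : subst) (t : typ S) (x : name t) : Prop :=
  ~ conv (theta t x) (Fvar x).

Definition subst_supp (theta : subst) (u : typ S) (a : name u) : Prop :=
  exists t (x : name t), dom theta x /\ supp (theta t x) a.

(* B[theta]; no capture can arise, since the range of [theta] consists of
   terms without de Bruijn variables. *)
Fixpoint fsubst (theta : subst) {G t} (e : term G t) : term G t :=
  match e with
  | Bvar m => Bvar m
  | Fvar x => weaken (theta _ x)
  | Nom a => Nom a
  | Cst k => Cst k
  | Log k => Log k
  | Lam e' => Lam (fsubst theta e')
  | App e1 e2 => App (fsubst theta e1) (fsubst theta e2)
  end.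

Definition avoids (pi : perm) (theta : subst) {G t} (e : term G t) : Prop :=
  forall u (a : name u), supp e a -> ~ subst_supp theta (pi u a).

(* [nsubst theta A B]: B is A<theta>, for some admissible choice of the
   renaming of nominal constants. *)
Definition nsubst (theta : subst) (A B : form S) : Prop :=
  exists pi : perm, avoids pi theta A /\ conv B (fsubst theta (pact pi A)).

Definition varset : Type := forall t : typ S, name t -> Prop.

Definition var_list {ts} (xs : hlist name ts) : varset :=
  fun t x => In (existT name t x) (hto_list xs).

Definition varset_union (V W : varset) : varset := fun t x => V t x \/ W t x.

Definition varset_add (V : varset) {u} (h : name u) : varset :=
  varset_union V (var_list (hcons h hnil)).

Definition varset_subst (V : varset) (theta : subst) : varset :=
  fun t x =>
    (V t x /\ ~ dom theta x) \/
    exists u (y : name u), dom theta y /\ fv (theta u y) x.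

(* range(theta) is a set of terms: none of them is a variable in V. *)
Definition range_disjoint (theta : subst) (V : varset) : Prop :=
  forall t (x y : name t), dom theta x -> V t y -> ~ conv (theta t x) (Fvar y).

Definition top : form S := Log Top.
Definition bot : form S := Log Bot.
Definition conj {G} (A B : term G Prp) : term G Prp := App (App (Log And) A) B.
Definition disj {G} (A B : term G Prp) : term G Prp := App (App (Log Or) A) B.
Definition impl {G} (A B : term G Prp) : term G Prp := App (App (Log Imp) A) B.
Definition forall_ {G t} (H : o_free t = true) (A : term G (Arr t Prp)) : term G Prp :=
  App (Log (All H)) A.
Definition exists_ {G t} (H : o_free t = true) (A : term G (Arr t Prp)) : term G Prp :=
  App (Log (Ex H)) A.
Definition nabla {G t} (H : o_free t = true) (A : term G (Arr t Prp)) : term G Prp :=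
  App (Log (Nabla H)) A.
Definition nabs {G t} (ts : list (typ S)) (e : term G (arrs ts t)) (e' : term G t) :
  term G Prp :=
  App (App (Log (NAbs ts t)) e) e'.

(* Replaces the nominal constant [a] by the bound variable [m]. *)
Fixpoint bind_nom {u} (a : name u) {G t} (e : term G t) : member u G -> term G t :=
  match e in term G0 t0 return member u G0 -> term G0 t0 with
  | Bvar m' => fun _ => Bvar m'
  | Fvar x => fun _ => Fvar x
  | @Nom _ G0 t0 b => fun m =>
      match ty_eq_dec (@base_eq_dec S) u t0 with
      | left E =>
          if Nat.eq_dec (name_index a) (name_index b)
          then Bvar (eq_rect u (fun v => member v G0) m t0 E)
          else Nom b
      | right _ => Nom b
      end
  | Cst k => fun _ => Cst k
  | Log k => fun _ => Log k
  | Lam e' => fun m => Lam (bind_nom a e' (MS m))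
  | App e1 e2 => fun m => App (bind_nom a e1 m) (bind_nom a e2 m)
  end.

(* lambda c_1 ... lambda c_n. e *)
Fixpoint abs_noms {ts t} (cs : hlist name ts) (e : @term S [] t) : term [] (arrs ts t) :=
  match cs in hlist _ ts0 return term [] (arrs ts0 t) with
  | hnil => e
  | hcons a cs' => Lam (bind_nom a (shift (abs_noms cs' e)) MZ)
  end.

Definition nabs_holds {t} (ts : list (typ S)) (e : @term S [] (arrs ts t))
  (e' : @term S [] t) : Prop :=
  exists cs : hlist name ts, NoDup (hto_list cs) /\ conv e (abs_noms cs e').

(* (e |> e')<theta> holds. *)
Definition solution (theta : subst) {t} (ts : list (typ S))
  (e : @term S [] (arrs ts t)) (e' : @term S [] t) : Prop :=
  exists pi : perm,
    avoids pi theta (nabs e e') /\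
    nabs_holds (fsubst theta (pact pi e)) (fsubst theta (pact pi e')).

Definition level_map : Type := forall ts, @const S ts None -> nat.

Inductive has_level (lvl : level_map) : forall G, term G Prp -> nat -> Prop :=
| level_conv : forall G (A B : term G Prp) n,
    conv A B -> has_level lvl A n -> has_level lvl B n
| level_atom : forall G ts (p : const ts None) (es : hlist (term G) ts),
    has_level lvl (apps (Cst p) es) (lvl ts p)
| level_top : forall G, has_level lvl (G := G) (Log Top) 0
| level_bot : forall G, has_level lvl (G := G) (Log Bot) 0
| level_nabs : forall G t ts (e : term G (arrs ts t)) (e' : term G t),
    has_level lvl (nabs e e') 0
| level_conj : forall G (A B : term G Prp) m n,
    has_level lvl A m -> has_level lvl B n -> has_level lvl (conj A B) (Nat.max m n)
| level_disj : forall G (A B : term G Prp) m n,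
    has_level lvl A m -> has_level lvl B n -> has_level lvl (disj A B) (Nat.max m n)
| level_impl : forall G (A B : term G Prp) m n,
    has_level lvl A m -> has_level lvl B n ->
    has_level lvl (impl A B) (Nat.max (1 + m) n)
| level_forall : forall G t (H : o_free t = true) (A : term (t :: G) Prp) n,
    has_level lvl A n -> has_level lvl (forall_ H (Lam A)) n
| level_exists : forall G t (H : o_free t = true) (A : term (t :: G) Prp) n,
    has_level lvl A n -> has_level lvl (exists_ H (Lam A)) n
| level_nabla : forall G t (H : o_free t = true) (A : term (t :: G) Prp) n,
    has_level lvl A n -> has_level lvl (nabla H (Lam A)) n.

(* [B] is the body of a clause for [p] whose variables x have the types [us];
   the last condition is  lvl (B (lambda y. T) x) < lvl p. *)
Definition body_ok (lvl : level_map) {ts} (p : const ts None) (us : list (typ S))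
  (B : @term S [] (Arr (arrs ts Prp) (arrs us Prp))) : Prop :=
  ~ occurs (SCst p) B /\ closed B /\ nominal_free B /\
  forall xs : hlist name us, NoDup (hto_list xs) ->
    exists2 n, has_level lvl (apps (App B (lams (ts := ts) (Log Top))) (fvars xs)) n & n < lvl ts p.

Inductive kind : Type := Fixpt | Inductive_ | Coinductive_.

Record clause : Type := Clause {
  cl_types : list (typ S);
  cl_pred : @const S cl_types None;
  cl_kind : kind;
  cl_body : @term S [] (Arr (arrs cl_types Prp) (arrs cl_types Prp))
}.

Definition cl_head (c : clause) : symbol := SCst (cl_pred c).

Definition definition_ok (lvl : level_map) (D : list clause) : Prop :=
  NoDup (map cl_head D) /\
  forall c, In c D -> body_ok lvl (cl_pred c) (cl_body c).

Definition sequent_ok (V : varset) (Gamma : list (form S)) (C : form S) : Prop :=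
  finite V /\ forall A, In A (C :: Gamma) -> forall t (x : name t), fv A x -> V t x.

(* The principal formula on the left is written first; [p_conv] makes
   signatures sets, antecedents multisets, and formulas conversion classes.  The
   invariant of [p_ind] and [p_coind] is closed: one premise has only the
   fresh xs as eigenvariables.  A<theta> depends on a choice of renaming; the
   premises of [p_nabsL] cover every choice. *)
Inductive provable (D : list clause) :
  varset -> list (form S) -> form S -> Prop :=
| p_conv : forall V V' Gamma Gamma0 Gamma' C C',
    (forall t (x : name t), V t x <-> V' t x) ->
    Permutation Gamma Gamma0 -> Forall2 (@conv [] Prp) Gamma0 Gamma' -> conv C C' ->
    provable D V Gamma C -> provable D V' Gamma' C'
| p_id : forall V Gamma A B,
    sequent_ok V (A :: Gamma) B -> equivariant A B -> provable D V (A :: Gamma) B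
| p_cut : forall V Gamma Delta B C,
    sequent_ok V (Gamma ++ Delta) C ->
    provable D V Gamma B -> provable D V (B :: Delta) C ->
    provable D V (Gamma ++ Delta) C
| p_contr : forall V Gamma B C,
    sequent_ok V (B :: Gamma) C ->
    provable D V (B :: B :: Gamma) C -> provable D V (B :: Gamma) C
| p_botL : forall V Gamma C,
    sequent_ok V (bot :: Gamma) C -> provable D V (bot :: Gamma) C
| p_topR : forall V Gamma,
    sequent_ok V Gamma top -> provable D V Gamma top
| p_disjL : forall V Gamma A B C,
    sequent_ok V (disj A B :: Gamma) C ->
    provable D V (A :: Gamma) C -> provable D V (B :: Gamma) C ->
    provable D V (disj A B :: Gamma) C
| p_disjR1 : forall V Gamma A B,
    sequent_ok V Gamma (disj A B) ->
    provable D V Gamma A -> provable D V Gamma (disj A B)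
| p_disjR2 : forall V Gamma A B,
    sequent_ok V Gamma (disj A B) ->
    provable D V Gamma B -> provable D V Gamma (disj A B)
| p_conjL1 : forall V Gamma A B C,
    sequent_ok V (conj A B :: Gamma) C ->
    provable D V (A :: Gamma) C -> provable D V (conj A B :: Gamma) C
| p_conjL2 : forall V Gamma A B C,
    sequent_ok V (conj A B :: Gamma) C ->
    provable D V (B :: Gamma) C -> provable D V (conj A B :: Gamma) C
| p_conjR : forall V Gamma A B,
    sequent_ok V Gamma (conj A B) ->
    provable D V Gamma A -> provable D V Gamma B -> provable D V Gamma (conj A B)
| p_implL : forall V Gamma A B C,
    sequent_ok V (impl A B :: Gamma) C ->
    provable D V Gamma A -> provable D V (B :: Gamma) C ->
    provable D V (impl A B :: Gamma) C
| p_implR : forall V Gamma A B,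
    sequent_ok V Gamma (impl A B) ->
    provable D V (A :: Gamma) B -> provable D V Gamma (impl A B)
| p_forallL : forall V Gamma t (H : o_free t = true) (A : term [] (Arr t Prp)) e C,
    sequent_ok V (forall_ H A :: Gamma) C ->
    (forall u (x : name u), fv e x -> V u x) ->
    provable D V (App A e :: Gamma) C -> provable D V (forall_ H A :: Gamma) C
| p_forallR : forall V Gamma t (H : o_free t = true) (A : term [] (Arr t Prp))
      ts (cs : hlist name ts) (h : name (arrs ts t)),
    sequent_ok V Gamma (forall_ H A) ->
    lists_supp cs A -> ~ V _ h ->
    provable D (varset_add V h) Gamma (App A (apps (Fvar h) (noms cs))) ->
    provable D V Gamma (forall_ H A)
| p_existsL : forall V Gamma t (H : o_free t = true) (A : term [] (Arr t Prp))
      ts (cs : hlist name ts) (h : name (arrs ts t)) C,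
    sequent_ok V (exists_ H A :: Gamma) C ->
    lists_supp cs A -> ~ V _ h ->
    provable D (varset_add V h) (App A (apps (Fvar h) (noms cs)) :: Gamma) C ->
    provable D V (exists_ H A :: Gamma) C
| p_existsR : forall V Gamma t (H : o_free t = true) (A : term [] (Arr t Prp)) e,
    sequent_ok V Gamma (exists_ H A) ->
    (forall u (x : name u), fv e x -> V u x) ->
    provable D V Gamma (App A e) -> provable D V Gamma (exists_ H A)
| p_nablaL : forall V Gamma t (H : o_free t = true) (A : term [] (Arr t Prp))
      (a : name t) C,
    sequent_ok V (nabla H A :: Gamma) C ->
    ~ supp A a ->
    provable D V (App A (Nom a) :: Gamma) C -> provable D V (nabla H A :: Gamma) C
| p_nablaR : forall V Gamma t (H : o_free t = true) (A : term [] (Arr t Prp))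
      (a : name t),
    sequent_ok V Gamma (nabla H A) ->
    ~ supp A a ->
    provable D V Gamma (App A (Nom a)) -> provable D V Gamma (nabla H A)
| p_nabsL : forall V Gamma t ts (e : term [] (arrs ts t)) (e' : term [] t) C,
    sequent_ok V (nabs e e' :: Gamma) C ->
    (forall theta, solution theta e e' ->
      forall Gamma' C', Forall2 (nsubst theta) Gamma Gamma' -> nsubst theta C C' ->
      provable D (varset_subst V theta) Gamma' C') ->
    provable D V (nabs e e' :: Gamma) C
| p_nabsR : forall V Gamma t ts (e : term [] (arrs ts t)) (e' : term [] t),
    sequent_ok V Gamma (nabs e e') ->
    nabs_holds e e' -> provable D V Gamma (nabs e e')
| p_defL : forall V Gamma c (es : hlist (term []) (cl_types c)) C,
    sequent_ok V (apps (Cst (cl_pred c)) es :: Gamma) C ->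
    In c D ->
    provable D V (apps (App (cl_body c) (Cst (cl_pred c))) es :: Gamma) C ->
    provable D V (apps (Cst (cl_pred c)) es :: Gamma) C
| p_defR : forall V Gamma c (es : hlist (term []) (cl_types c)),
    sequent_ok V Gamma (apps (Cst (cl_pred c)) es) ->
    In c D ->
    provable D V Gamma (apps (App (cl_body c) (Cst (cl_pred c))) es) ->
    provable D V Gamma (apps (Cst (cl_pred c)) es)
| p_ind : forall V Gamma c (es : hlist (term []) (cl_types c))
      (I : term [] (arrs (cl_types c) Prp)) (xs : hlist name (cl_types c)) C,
    sequent_ok V (apps (Cst (cl_pred c)) es :: Gamma) C ->
    In c D -> cl_kind c = Inductive_ ->
    closed I -> nominal_free I -> NoDup (hto_list xs) ->
    provable D (var_list xs) [apps (App (cl_body c) I) (fvars xs)] (apps I (fvars xs)) ->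
    provable D V (apps I es :: Gamma) C ->
    provable D V (apps (Cst (cl_pred c)) es :: Gamma) C
| p_coind : forall V Gamma c (es : hlist (term []) (cl_types c))
      (I : term [] (arrs (cl_types c) Prp)) (xs : hlist name (cl_types c)),
    sequent_ok V Gamma (apps (Cst (cl_pred c)) es) ->
    In c D -> cl_kind c = Coinductive_ ->
    closed I -> nominal_free I -> NoDup (hto_list xs) ->
    provable D V Gamma (apps I es) ->
    provable D (var_list xs) [apps I (fvars xs)] (apps (App (cl_body c) I) (fvars xs)) ->
    provable D V Gamma (apps (Cst (cl_pred c)) es).

(* The clause  forall x. (nabla z. p t) := B p x  for a predicate p with
   argument types [ts]: [pc_xs] and [pc_zs] are the types of x and z, and
   [pc_args] are the terms t, in which x and z are de Bruijn variables. *)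
Record pclause (ts : list (typ S)) : Type := PClause {
  pc_xs : list (typ S);
  pc_zs : list (typ S);
  pc_xs_o_free : forallb o_free pc_xs = true;
  pc_zs_o_free : forallb o_free pc_zs = true;
  pc_args : hlist (term (rev_append pc_zs (rev_append pc_xs []))) ts;
  pc_body : @term S [] (Arr (arrs ts Prp) (arrs pc_xs Prp))
}.

(* lambda x. lambda z. k t.  The instance of (lambda z. k t) at terms es for x is
   written [apps (pc_head k c) es], to which it is convertible. *)
Definition pc_head {ts r} (k : const ts r) (c : pclause ts) :
  term [] (arrs (pc_xs c) (arrs (pc_zs c) (target r))) :=
  lams (lams (apps (Cst k) (pc_args c))).

Definition pc_inst {ts} (p : const ts None) (c : pclause ts)
  (es : hlist (term []) (pc_xs c)) : form S :=
  apps (App (pc_body c) (Cst p)) es.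
Arguments pc_inst {ts} p c es.

Definition pclauses_ok (lvl : level_map) {ts} (p : const ts None)
  (pcs : list (pclause ts)) : Prop :=
  forall c, In c pcs ->
    (forall e, In e (hto_list (pc_args c)) ->
      closed (projT2 e) /\ nominal_free (projT2 e)) /\
    body_ok lvl p (pc_body c).

Fixpoint disj_list {G} (As : list (term G Prp)) : term G Prp :=
  match As with
  | [] => Log Bot
  | [A] => A
  | A :: As' => disj A (disj_list As')
  end.

Fixpoint exists_list {xs : list (typ S)} {G} :
  forallb o_free xs = true -> term (rev_append xs G) Prp -> term G Prp :=
  match xs return forallb o_free xs = true -> term (rev_append xs G) Prp -> term G Prp with
  | [] => fun _ A => A
  | u :: xs' => fun H A =>
      let H' := andb_prop _ _ H in
      exists_ (proj1 H') (Lam (@exists_list xs' (u :: G) (proj2 H') A))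
  end.

(* exists x. ((lambda z. p' t) |> p' y) /\ B P x, where P is a variable for the
   predicate and y are the variables bound next, followed by x. *)
Definition pc_disjunct {ts r} (p' : const ts r) (c : pclause ts) :
  term (rev_append ts [arrs ts Prp]) Prp :=
  exists_list (pc_xs_o_free c)
    (conj
      (nabs (apps (weaken (pc_head p' c)) (bound_vars (pc_xs c) _))
            (apps (Cst p')
              (hmap (fun _ e => ren e (fun _ m => member_under m)) (bound_vars ts _))))
      (apps (App (weaken (pc_body c)) (Bvar (member_under (member_under MZ))))
            (bound_vars (pc_xs c) _))).

Definition translate {ts r} (p : const ts None) (p' : const ts r)
  (pcs : list (pclause ts)) : clause :=
  Clause p Fixpt (Lam (lams (disj_list (map (pc_disjunct p') pcs)))).

(* [D0] are the clauses for the predicates other than p. *)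
Definition new_const (D0 : list clause) {ts r} (p : const ts None) (p' : const ts r)
  (pcs : list (pclause ts)) : Prop :=
  SCst p' <> SCst p /\
  (forall c, In c D0 -> SCst p' <> cl_head c /\ ~ occurs (SCst p') (cl_body c)) /\
  (forall c, In c pcs ->
    (forall e, In e (hto_list (pc_args c)) -> ~ occurs (SCst p') (projT2 e)) /\
    ~ occurs (SCst p') (pc_body c)).

(* Admissibility in the logic with the clauses [D] of the right rule: xs are the
   names given to the bound variables of the clause. *)
Definition defRp_admissible (D : list clause) {ts} (p : const ts None)
  (pcs : list (pclause ts)) : Prop :=
  forall (V : varset) (Gamma : list (form S)) (es : hlist (term []) ts)
         (c : pclause ts) (xs : hlist name (pc_xs c)) (theta : subst),
    sequent_ok V Gamma (apps (Cst p) es) ->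
    In c pcs -> NoDup (hto_list xs) ->
    range_disjoint theta V ->
    nabs_holds (fsubst theta (apps (pc_head p c) (fvars xs))) (apps (Cst p) es) ->
    provable D V Gamma (fsubst theta (pc_inst p c (fvars xs))) ->
    provable D V Gamma (apps (Cst p) es).

(* The terms h cs, for eigenvariables h of the types of x raised over the
   types [us] of the nominal constants cs. *)
Fixpoint raised {xs us : list (typ S)} (cs : hlist name us) :
  hlist name (map (arrs us) xs) -> hlist (@term S []) xs :=
  match xs return hlist name (map (arrs us) xs) -> hlist (@term S []) xs with
  | [] => fun _ => hnil
  | t :: xs' => fun hs =>
      match hs in hlist _ l
        return match l with
               | [] => unit
               | u :: l' => (name u -> term [] t) ->
                            (hlist name l' -> hlist (@term S []) xs') ->
                            hlist (@term S []) (t :: xs')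
               end with
      | hnil => tt
      | hcons h hs' => fun f g => hcons (f h) (g hs')
      end (fun h => apps (Fvar h) (noms cs)) (raised cs)
  end.

(* Admissibility of the left rule.  The variables x of a clause are introduced
   as those of an existential quantifier are by [p_existsL]: as fresh
   eigenvariables hs, raised over the support cs of the atom.  If the atom has no
   nominal constants then cs is empty and [raised cs hs] is just hs.  Without
   raising the rule is unsound: for the clause  forall x. p x := T  and a nominal
   constant a, the problem  p x |> p a  has no solution (a is renamed away from
   the support of the substitution), so that  p a |- bot  would follow from no
   premise, although p a is provable. *)
Definition defLp_admissible (D : list clause) {ts} (p : const ts None)
  (pcs : list (pclause ts)) : Prop :=
  forall (V : varset) (Gamma : list (form S)) (es : hlist (term []) ts) (C : form S)
         (us : list (typ S)) (cs : hlist name us),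
    sequent_ok V (apps (Cst p) es :: Gamma) C ->
    lists_supp cs (apps (Cst p) es) ->
    (forall c : pclause ts, In c pcs ->
      exists hs : hlist name (map (arrs us) (pc_xs c)),
        NoDup (hto_list hs) /\
        (forall t (h : name t), var_list hs h -> ~ V t h) /\
        forall theta : subst,
          solution theta (apps (pc_head p c) (raised cs hs)) (apps (Cst p) es) ->
          forall Gamma' B' C',
            Forall2 (nsubst theta) Gamma Gamma' ->
            nsubst theta (pc_inst p c (raised cs hs)) B' ->
            nsubst theta C C' ->
            provable D (varset_subst (varset_union V (var_list hs)) theta)
              (B' :: Gamma') C') ->
    provable D V (apps (Cst p) es :: Gamma) C.

End Syntax.

Arguments pc_inst {S ts} p c es.

(* Main.v *)
From Stdlib Require Import FunctionalExtensionality ClassicalEpsilon Eqdep_dec.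
Require Import Defs.

Set Implicit Arguments.
Unset Strict Implicit.
Unset Printing Implicit Defensive.

(** Unfolding the translated clause, choosing a disjunct, instantiating the
    existential quantifiers and using the rules for nominal abstraction turns each
    of the two pattern rules into a derivation of the logic.  What has to be
    checked is that [(lambda z. p t) |> p s] and [(lambda z. p' t) |> p' s] have
    the same solutions and the same support, and that the eigenvariables of the
    existential quantifiers are raised over exactly the support of [p s].  Both
    follow from injectivity of neutral terms modulo beta-eta-conversion (if
    [k es] and [k es'] are convertible then so are the arguments), which is
    obtained from a Kripke logical relation whose base case compares weak head
    normal forms.

    Occurrence in a conversion class is handled algebraically: all symbols
    occurring in [e] belong to [P] iff [e] is convertible to the term obtained
    from [e] by replacing the variables outside [P] by nominal constants of the
    same name, and conversely. *)

(** * Elimination principles for the indexed families *)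

(** The motive is abstracted as [Q] inside a match on the index list, so that dependent elimination
    goes through without an equality axiom. It serves to compare substitutions on a lifted context,
    variable by variable. *)
Lemma member_cons_ind {A : Type} (u : A) (G : list A)
  (P : forall t, member t (u :: G) -> Prop) :
  P u MZ -> (forall t (m : member t G), P t (MS m)) -> forall t m, P t m.
Proof.
  intros HZ HS t m.
  refine (match m as m0 in member _ l return
            match l as l0 return member t l0 -> Prop with
            | [] => fun _ => True
            | v :: l' => fun m0 => forall Q : forall t, member t (v :: l') -> Prop,
                Q v MZ -> (forall t (m : member t l'), Q t (MS m)) -> Q t m0
            end m0 with
          | MZ => fun Q H _ => H
          | MS m' => fun Q _ H => H _ m'
          end P HZ HS).
Qed.

Lemma hlist_cons_inv {A : Type} {F : A -> Type} (a : A) (l : list A)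
  (h : hlist F (a :: l)) : exists x h', h = hcons x h'.
Proof.
  refine (match h as h0 in hlist _ l0 return
            match l0 as l1 return hlist F l1 -> Prop with
            | [] => fun _ => True
            | b :: l' => fun h0 => exists x h', h0 = hcons x h'
            end h0 with
          | hnil => I
          | hcons x h' => ex_intro _ x (ex_intro _ h' eq_refl)
          end).
Qed.

Lemma hlist_nil_inv {A : Type} {F : A -> Type} (h : hlist F []) : h = hnil.
Proof.
  refine (match h as h0 in hlist _ l0 return
            match l0 as l1 return hlist F l1 -> Prop with
            | [] => fun h0 => h0 = hnil
            | b :: l' => fun _ => True
            end h0 with
          | hnil => eq_refl
          | hcons x h' => I
          end).
Qed.

Lemma hmap_hmap {A : Type} {F G H : A -> Type} (f : forall a, F a -> G a)
  (g : forall a, G a -> H a) l (h : hlist F l) :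
  hmap g (hmap f h) = hmap (fun a x => g a (f a x)) h.
Proof. induction h; simpl; congruence. Qed.

Lemma hmap_ext {A : Type} {F G : A -> Type} (f g : forall a, F a -> G a) l
  (h : hlist F l) : (forall a x, f a x = g a x) -> hmap f h = hmap g h.
Proof. intros E; induction h; simpl; congruence. Qed.

(** * Simultaneous substitution *)

Section Substitution.
Context {S : signature}.
Implicit Types (G D E : list (typ S)) (t u : typ S).

(* A map on all three sorts of variable-like symbols at once: [ren], [bsubst],
   [fsubst], [pact] and [bind_nom] are all instances. *)
Record gs G D : Type := GS {
  gv : forall t, name t -> term D t;
  gn : forall t, name t -> term D t;
  gb : forall t, member t G -> term D t
}.

(** The images of variables and nominal constants are shifted too: they live in the target context
    and may mention its bound variables, as happens when [bind_nom] turns a nominal constant into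
    one. *)
Definition glift {G D u} (s : gs G D) : gs (u :: G) (u :: D) :=
  GS (fun t x => shift (gv s x)) (fun t a => shift (gn s a)) (sub_lift (gb s)).

Fixpoint gsub {G t} (e : term G t) : forall D, gs G D -> term D t :=
  match e in term G0 t0 return forall D, gs G0 D -> term D t0 with
  | Bvar m => fun D s => gb s m
  | Fvar x => fun D s => gv s x
  | Nom a => fun D s => gn s a
  | Cst k => fun D s => Cst k
  | Log k => fun D s => Log k
  | Lam e' => fun D s => Lam (gsub e' (glift s))
  | App e1 e2 => fun D s => App (gsub e1 s) (gsub e2 s)
  end.

Lemma gs_ext G D (s s' : gs G D) :
  (forall t (x : name t), gv s x = gv s' x) ->
  (forall t (a : name t), gn s a = gn s' a) ->
  (forall t (m : member t G), gb s m = gb s' m) -> s = s'.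
Proof.
  destruct s as [f g h], s' as [f' g' h']; simpl; intros Hf Hg Hh.
  f_equal; apply functional_extensionality_dep; intro;
    apply functional_extensionality_dep; auto.
Qed.

Definition gren {G D} (r : forall t, member t G -> member t D) : gs G D :=
  GS (fun _ x => Fvar x) (fun _ a => Nom a) (fun t m => Bvar (r t m)).

Definition gbs {G D} (h : forall t, member t G -> term D t) : gs G D :=
  GS (fun _ x => Fvar x) (fun _ a => Nom a) h.

Lemma ren_gsub G t (e : term G t) D (r : forall t, member t G -> member t D) :
  ren e r = gsub e (gren r).
Proof.
  revert D r; induction e; intros D w; simpl; try reflexivity;
    [|rewrite IHe1, IHe2; reflexivity].
  rewrite IHe; do 2 f_equal.
  apply gs_ext; try reflexivity.
  apply member_cons_ind; reflexivity.
Qed.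

Lemma gsub_ren G t (e : term G t) D (r : forall t, member t G -> member t D)
  E (s : gs D E) :
  gsub (ren e r) s = gsub e (GS (gv s) (gn s) (fun t m => gb s (r t m))).
Proof.
  revert D r E s; induction e; intros D w E s; simpl; try reflexivity;
    [|rewrite IHe1, IHe2; reflexivity].
  rewrite IHe; do 2 f_equal.
  apply gs_ext; try reflexivity.
  apply member_cons_ind; reflexivity.
Qed.

Lemma ren_ren G t (e : term G t) D (r : forall t, member t G -> member t D)
  E (r' : forall t, member t D -> member t E) :
  ren (ren e r) r' = ren e (fun t m => r' t (r t m)).
Proof. rewrite !(ren_gsub _ r'), gsub_ren, ren_gsub; reflexivity. Qed.

Lemma ren_of_gsub G t (e : term G t) D (s : gs G D)
  E (r : forall t, member t D -> member t E) :
  ren (gsub e s) r =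
  gsub e (GS (fun t x => ren (gv s x) r) (fun t a => ren (gn s a) r)
             (fun t m => ren (gb s m) r)).
Proof.
  revert D s E r; induction e; intros D s E w; simpl; try reflexivity;
    [|rewrite IHe1, IHe2; reflexivity].
  rewrite IHe; do 2 f_equal.
  apply gs_ext; simpl.
  - intros; unfold shift; rewrite !ren_ren; reflexivity.
  - intros; unfold shift; rewrite !ren_ren; reflexivity.
  - apply member_cons_ind; [reflexivity|].
    intros; simpl; unfold shift; rewrite !ren_ren; reflexivity.
Qed.

Lemma gsub_shift G t u (e : term G t) D (s : gs G D) :
  gsub (shift (u := u) e) (glift s) = shift (gsub e s).
Proof. unfold shift; rewrite gsub_ren, ren_of_gsub; reflexivity. Qed.

Definition gcomp {G D E} (s : gs G D) (s' : gs D E) : gs G E :=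
  GS (fun t x => gsub (gv s x) s') (fun t a => gsub (gn s a) s')
     (fun t m => gsub (gb s m) s').

(** Composition with a renaming on either side has to come first, since these two laws give
    [gsub_shift], which the case of [Lam] needs here. *)
Lemma gsub_gsub G t (e : term G t) D (s : gs G D) E (s' : gs D E) :
  gsub (gsub e s) s' = gsub e (gcomp s s').
Proof.
  revert D s E s'; induction e; intros D s E s'; simpl; try reflexivity;
    [|rewrite IHe1, IHe2; reflexivity].
  rewrite IHe; do 2 f_equal.
  apply gs_ext; simpl; try (intros; apply gsub_shift).
  apply member_cons_ind; [reflexivity|].
  intros; simpl; apply gsub_shift.
Qed.

Definition gid {G} : gs G G := gbs (fun _ m => Bvar m).

Lemma glift_id G u : glift (u := u) (@gid G) = gid.
Proof. apply gs_ext; try reflexivity. apply member_cons_ind; reflexivity. Qed.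

Lemma gsub_id G t (e : term G t) : gsub e gid = e.
Proof. induction e; simpl; try reflexivity;
    [|rewrite IHe1, IHe2; reflexivity]. rewrite glift_id; congruence. Qed.

Lemma ren_id G t (e : term G t) : ren e (fun _ m => m) = e.
Proof. rewrite ren_gsub; apply gsub_id. Qed.

Lemma bsubst_gsub G t (e : term G t) D (h : forall t, member t G -> term D t) :
  bsubst e h = gsub e (gbs h).
Proof.
  revert D h; induction e; intros D h; simpl; try reflexivity;
    [|rewrite IHe1, IHe2; reflexivity].
  rewrite IHe; reflexivity.
Qed.

Lemma gsub_weaken G t (e : term [] t) D (s : gs G D) (s' : gs [] D) :
  (forall t (x : name t), gv s x = gv s' x) ->
  (forall t (a : name t), gn s a = gn s' a) ->
  gsub (weaken e) s = gsub e s'.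
Proof.
  intros Hv Hn; unfold weaken; rewrite gsub_ren; f_equal.
  apply gs_ext; auto. intros u m; exact (no_member m).
Qed.

Lemma bsubst_weaken G t (e : term [] t) (h : forall t, member t G -> term [] t) :
  bsubst (weaken e) h = e.
Proof.
  rewrite bsubst_gsub, (@gsub_weaken _ _ _ _ _ gid), gsub_id; reflexivity.
Qed.

Definition gfs (theta : subst) {G} : gs G G :=
  GS (fun _ x => weaken (theta _ x)) (fun _ a => Nom a) (fun _ m => Bvar m).

Lemma fsubst_gsub (theta : subst) G t (e : term G t) :
  fsubst theta e = gsub e (gfs theta).
Proof.
  induction e; simpl; try reflexivity;
    [|rewrite IHe1, IHe2; reflexivity].
  rewrite IHe; do 2 f_equal; apply gs_ext; try reflexivity.
  - intros v x; simpl; unfold weaken, shift; rewrite ren_ren; f_equal.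
    apply functional_extensionality_dep; intro.
    apply functional_extensionality_dep; intro m; exact (no_member m).
  - apply member_cons_ind; reflexivity.
Qed.

Definition gpa (pi : perm) {G} : gs G G :=
  GS (fun _ x => Fvar x) (fun _ a => Nom (pi _ a)) (fun _ m => Bvar m).

Lemma pact_gsub (pi : perm) G t (e : term G t) : pact pi e = gsub e (gpa pi).
Proof.
  induction e; simpl; try reflexivity;
    [|rewrite IHe1, IHe2; reflexivity].
  rewrite IHe; do 2 f_equal; apply gs_ext; try reflexivity.
  apply member_cons_ind; reflexivity.
Qed.

(** The component on nominal constants calls [bind_nom] itself on [Nom b], which avoids repeating
    the transport along an equality of types. *)
Definition gbn {u} (a : name u) {G} (m : member u G) : gs G G :=
  GS (fun _ x => Fvar x) (fun _ b => bind_nom a (Nom b) m) (fun _ m => Bvar m).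

Lemma bind_nom_gsub u (a : name u) G t (e : term G t) (m : member u G) :
  bind_nom a e m = gsub e (gbn a m).
Proof.
  revert m; induction e; intros m'; simpl; try reflexivity;
    [|rewrite IHe1, IHe2; reflexivity].
  rewrite IHe; do 2 f_equal; apply gs_ext; try reflexivity.
  - intros v b; simpl.
    destruct (ty_eq_dec _ u v) as [Ev|]; [|reflexivity].
    destruct (Nat.eq_dec _ _); [|reflexivity].
    subst v; reflexivity.
  - apply member_cons_ind; reflexivity.
Qed.

Lemma gsub_apps G ts t (e : term G (arrs ts t)) (es : hlist (term G) ts)
  D (s : gs G D) :
  gsub (apps e es) s = apps (gsub e s) (hmap (fun _ e => gsub e s) es).
Proof.
  revert e; induction es; intros e; simpl; [reflexivity|].
  rewrite IHes; reflexivity.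
Qed.

Lemma bsubst_apps G ts t (e : term G (arrs ts t)) (es : hlist (term G) ts)
  D (h : forall t, member t G -> term D t) :
  bsubst (apps e es) h = apps (bsubst e h) (hmap (fun _ e => bsubst e h) es).
Proof.
  rewrite !bsubst_gsub, gsub_apps; f_equal; apply hmap_ext; intros;
    symmetry; apply bsubst_gsub.
Qed.

Fixpoint glifts (ts : list (typ S)) {G D} : gs G D -> gs (rev_append ts G) (rev_append ts D) :=
  match ts return gs G D -> gs (rev_append ts G) (rev_append ts D) with
  | [] => fun s => s
  | u :: ts' => fun s => glifts ts' (glift s)
  end.

Lemma gsub_lams ts G t (e : term (rev_append ts G) t) D (s : gs G D) :
  gsub (lams e) s = lams (gsub e (glifts ts s)).
Proof.
  revert G D e s; induction ts as [|u ts IH]; intros; simpl; [reflexivity|].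
  rewrite IH; reflexivity.
Qed.

Lemma bsubst_shift_cons G t u (e : term G t) D (e' : term D u)
  (h : forall t, member t G -> term D t) :
  bsubst (shift e) (sub_cons e' h) = bsubst e h.
Proof. rewrite !bsubst_gsub; unfold shift; rewrite gsub_ren; reflexivity. Qed.

Lemma bsubst_lift_cons G u t (e : term (u :: G) t) D
  (h : forall t, member t G -> term D t) (e' : term D u) :
  bsubst (bsubst e (sub_lift h)) (sub_cons e' (fun _ m => Bvar m)) =
  bsubst e (sub_cons e' h).
Proof.
  rewrite !bsubst_gsub, gsub_gsub; f_equal; apply gs_ext; try reflexivity.
  apply member_cons_ind; [reflexivity|]; intros v m; simpl.
  rewrite <- bsubst_gsub, bsubst_shift_cons, bsubst_gsub; apply gsub_id.
Qed.

(** * Conversion and substitution *)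

Lemma conv_gsub G t (e e' : term G t) : conv e e' ->
  forall D (s : gs G D), conv (gsub e s) (gsub e' s).
Proof.
  induction 1; intros D s; simpl.
  - eapply conv_trans; [apply conv_beta|].
    rewrite !bsubst_gsub, !gsub_gsub.
    match goal with |- conv (gsub e ?a) (gsub e ?b) => replace a with b end.
    { apply conv_refl. }
    apply gs_ext; simpl.
    + intros; rewrite <- bsubst_gsub, bsubst_shift_cons, bsubst_gsub, gsub_id;
        reflexivity.
    + intros; rewrite <- bsubst_gsub, bsubst_shift_cons, bsubst_gsub, gsub_id;
        reflexivity.
    + apply member_cons_ind; [reflexivity|]; intros; simpl.
      rewrite <- bsubst_gsub, bsubst_shift_cons, bsubst_gsub, gsub_id;
        reflexivity.
  - rewrite gsub_shift; apply conv_eta.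
  - apply conv_lam; auto.
  - apply conv_app; auto.
  - apply conv_refl.
  - apply conv_sym; auto.
  - eapply conv_trans; eauto.
Qed.

Lemma conv_ren G t (e e' : term G t) D (r : forall t, member t G -> member t D) :
  conv e e' -> conv (ren e r) (ren e' r).
Proof. rewrite !ren_gsub; intros; apply conv_gsub; assumption. Qed.

Lemma conv_bsubst G t (e e' : term G t) D (h : forall t, member t G -> term D t) :
  conv e e' -> conv (bsubst e h) (bsubst e' h).
Proof. rewrite !bsubst_gsub; intros; apply conv_gsub; assumption. Qed.

Lemma bsubst_conv G t (e : term G t) D (h h' : forall t, member t G -> term D t) :
  (forall t (m : member t G), conv (h t m) (h' t m)) ->
  conv (bsubst e h) (bsubst e h').
Proof.
  revert D h h'; induction e; intros D h h' H; simpl; try apply conv_refl; auto.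
  - apply conv_lam, IHe.
    apply member_cons_ind; [apply conv_refl|].
    intros; apply conv_ren, H.
  - apply conv_app; auto.
Qed.

(** Applying both abstractions, shifted, to the newest bound variable undoes them up to beta. *)
Lemma Lam_inj G t u (e e' : term (t :: G) u) : conv (Lam e) (Lam e') -> conv e e'.
Proof.
  intros H.
  assert (K : forall f : term (t :: G) u, conv (App (shift (Lam f)) (Bvar MZ)) f).
  { intros f; unfold shift; simpl.
    eapply conv_trans; [apply conv_beta|].
    rewrite bsubst_gsub, gsub_ren.
    match goal with |- conv (gsub f ?a) _ => replace a with (@gid (t :: G)) end.
    { rewrite gsub_id; apply conv_refl. }
    apply gs_ext; try reflexivity. apply member_cons_ind; reflexivity. }
  eapply conv_trans; [apply conv_sym, K|].
  eapply conv_trans; [|apply K].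
  apply conv_app; [apply conv_ren, H|apply conv_refl].
Qed.

Lemma lams_inj ts G t (e e' : term (rev_append ts G) t) :
  conv (lams e) (lams e') -> conv e e'.
Proof.
  revert G e e'; induction ts as [|u ts IH]; intros G e e' H; simpl in *; auto.
  apply IH, Lam_inj, H.
Qed.

Lemma conv_lams ts G t (e e' : term (rev_append ts G) t) :
  conv e e' -> conv (lams e) (lams e').
Proof.
  revert G e e'; induction ts as [|u ts IH]; intros G e e' H; simpl in *; auto.
  apply conv_lam, IH, H.
Qed.

Inductive hconv {G} : forall ts, hlist (term G) ts -> hlist (term G) ts -> Prop :=
| hconv_nil : hconv hnil hnil
| hconv_cons : forall t ts (e e' : term G t) (es es' : hlist (term G) ts),
    conv e e' -> hconv es es' -> hconv (hcons e es) (hcons e' es').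

Lemma hconv_refl G ts (es : hlist (term G) ts) : hconv es es.
Proof. induction es; constructor; auto using conv_refl. Qed.

Lemma conv_apps G ts t (e e' : term G (arrs ts t)) (es es' : hlist (term G) ts) :
  conv e e' -> hconv es es' -> conv (apps e es) (apps e' es').
Proof.
  intros He Hes; revert e e' He.
  induction Hes; intros; simpl; auto using conv_app.
Qed.

(** The environment for the body of [lams ts]: the first term of [es] is consed first and so
    replaces the outermost variable, in agreement with [rev_append]. *)
Fixpoint ext {G D ts} (h : forall t, member t G -> term D t) (es : hlist (term D) ts) :
  forall t, member t (rev_append ts G) -> term D t :=
  match es in hlist _ ts0
    return (forall t, member t G -> term D t) ->
           forall t, member t (rev_append ts0 G) -> term D t with
  | hnil => fun h => h
  | hcons e es' => fun h => ext (sub_cons e h) es'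
  end h.

Lemma ext_member_under G D ts (es : hlist (term D) ts)
  (h : forall t, member t G -> term D t) t (m : member t G) :
  ext h es (member_under (ts := ts) m) = h t m.
Proof.
  revert G h m; induction es; intros G h m; simpl; [reflexivity|].
  rewrite IHes; reflexivity.
Qed.

Lemma bsubst_bound_vars G D ts (es : hlist (term D) ts)
  (h : forall t, member t G -> term D t) :
  hmap (fun _ e => bsubst e (ext h es)) (bound_vars ts G) = es.
Proof.
  revert G h; induction es; intros G h; simpl; [reflexivity|].
  rewrite ext_member_under; simpl; f_equal; apply IHes.
Qed.

(** Iterated beta-reduction. The environment [h] is carried along because after each step the next
    abstraction lies under the previous substitution. *)
Lemma apps_lams ts G D t (e : term (rev_append ts G) t)
  (h : forall t, member t G -> term D t) (es : hlist (term D) ts) :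
  conv (apps (bsubst (lams e) h) es) (bsubst e (ext h es)).
Proof.
  revert G e h; induction es; intros G e h; simpl; [apply conv_refl|].
  eapply conv_trans; [apply conv_apps; [apply conv_beta|apply hconv_refl]|].
  rewrite bsubst_lift_cons; apply IHes.
Qed.

(** * Injectivity of neutral terms *)

Definition lam_res G (T : typ S) : Type :=
  match T with Arr t u => option (term (t :: G) u) | _ => unit end.

Definition lam_none G (T : typ S) : lam_res G T :=
  match T return lam_res G T with Arr _ _ => None | _ => tt end.

(** Whether a term of type [T] is an abstraction can only be asked at an arrow, so the answer has a
    type computed from [T]. Constants, whose type [arrs ts (target r)] does not expose its head, are
    covered by [lam_none]. *)
Definition lam_view {G T} (e : term G T) : lam_res G T :=
  match e in term G0 T0 return lam_res G0 T0 with
  | Lam b => Some b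
  | @Bvar _ G0 T0 _ => lam_none G0 T0
  | @Fvar _ G0 T0 _ => lam_none G0 T0
  | @Nom _ G0 T0 _ => lam_none G0 T0
  | @Cst _ G0 ts r _ => lam_none G0 (arrs ts (target r))
  | @Log _ G0 T0 _ => lam_none G0 T0
  | @App _ G0 _ T0 _ _ => lam_none G0 T0
  end.

Definition app_view {G T} (e : term G T) :
  option {s : typ S & (term G (Arr s T) * term G s)%type} :=
  match e in term G0 T0
    return option {s : typ S & (term G0 (Arr s T0) * term G0 s)%type} with
  | App f a => Some (existT _ _ (f, a))
  | _ => None
  end.

(** Reduction is a function, which makes weak head normal forms unique without a confluence
    argument. *)
Fixpoint whstep {G T} (e : term G T) : option (term G T) :=
  match e in term G0 T0 return option (term G0 T0) with
  | @App _ G0 t0 u0 f a =>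
      match (lam_view f : option (term (t0 :: G0) u0)) with
      | Some b => Some (bsubst b (sub_cons a (fun _ m => Bvar m)))
      | None => match whstep f with Some f' => Some (App f' a) | None => None end
      end
  | _ => None
  end.

Inductive whred {G T} : term G T -> term G T -> Prop :=
| whred_refl : forall e, whred e e
| whred_step : forall e e1 n, whstep e = Some e1 -> whred e1 n -> whred e n.

Lemma whred_None G T (e n : term G T) : whred e n -> whstep e = None -> n = e.
Proof. intros H E; destruct H; congruence. Qed.

Lemma whred_det G T (e n n' : term G T) :
  whred e n -> whred e n' -> whstep n = None -> whstep n' = None -> n = n'.
Proof.
  induction 1 as [e|e e1 n He H IH]; intros H' N N'.
  - symmetry; apply whred_None; assumption.
  - destruct H' as [e|e e2 n' He2 H']; [congruence|].
    rewrite He in He2; injection He2 as <-; auto.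
Qed.

Lemma lam_view_Lam G T (e : term G T) :
  match T return term G T -> lam_res G T -> Prop with
  | Arr t u => fun e r => forall b, r = Some b -> e = Lam b
  | _ => fun _ _ => True
  end e (lam_view e).
Proof.
  assert (K : forall G T (e : term G T),
    match T return term G T -> lam_res G T -> Prop with
    | Arr t u => fun e r => forall b, r = Some b -> e = Lam b
    | _ => fun _ _ => True
    end e (lam_none G T)).
  { intros G0 [| |] e0; simpl; try exact I; intros; discriminate. }
  destruct e; simpl; try apply K.
  intros b E; injection E as ->; reflexivity.
Qed.

Lemma lam_view_ren G T (e : term G T) D (r : forall t, member t G -> member t D) :
  lam_view (ren e r) =
  match T return lam_res G T -> lam_res D T with
  | Arr t u => fun o => match o with Some b => Some (ren b (ren_lift r)) | None => None end
  | _ => fun _ => tt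
  end (lam_view e).
Proof.
  assert (K : forall T, lam_none D T =
    match T return lam_res G T -> lam_res D T with
    | Arr t u => fun o => match o with Some b => Some (ren b (ren_lift r)) | None => None end
    | _ => fun _ => tt
    end (lam_none G T)) by (intros [| |]; reflexivity).
  destruct e; simpl; try apply K; reflexivity.
Qed.

Lemma whstep_conv G T (e e1 : term G T) : whstep e = Some e1 -> conv e e1.
Proof.
  revert e1; induction e; intros e' E; simpl in E; try discriminate.
  pose proof (lam_view_Lam e1) as L; simpl in L.
  destruct (lam_view e1) as [b|].
  - injection E as <-. rewrite (L b eq_refl); apply conv_beta.
  - destruct (whstep e1) as [f'|]; [|discriminate].
    injection E as <-. apply conv_app; auto using conv_refl.
Qed.

Lemma whred_conv G T (e n : term G T) : whred e n -> conv e n.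
Proof.
  induction 1; [apply conv_refl|]. eapply conv_trans; eauto using whstep_conv.
Qed.

Lemma whstep_ren G T (e e1 : term G T) D (r : forall t, member t G -> member t D) :
  whstep e = Some e1 -> whstep (ren e r) = Some (ren e1 r).
Proof.
  revert e1 D r; induction e; intros e' D w E; simpl in E |- *; try discriminate.
  rewrite lam_view_ren; simpl.
  destruct (lam_view e1) as [b|].
  - injection E as <-. f_equal.
    rewrite !bsubst_gsub, gsub_ren, ren_of_gsub; f_equal.
    apply gs_ext; try reflexivity.
    apply member_cons_ind; reflexivity.
  - destruct (whstep e1) as [f'|]; [|discriminate].
    injection E as <-. rewrite (IHe1 f'); reflexivity.
Qed.

Lemma whred_ren G T (e n : term G T) D (r : forall t, member t G -> member t D) :
  whred e n -> whred (ren e r) (ren n r).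
Proof.
  induction 1; [constructor|]. econstructor; eauto using whstep_ren.
Qed.

Lemma whstep_not_Lam G T (e e1 : term G T) :
  whstep e = Some e1 -> lam_view e = lam_none G T.
Proof. destruct e; simpl; intros; try discriminate; reflexivity. Qed.

Lemma whstep_App G t u (e e1 : term G (Arr t u)) a :
  whstep e = Some e1 -> whstep (App e a) = Some (App e1 a).
Proof.
  intros E; simpl.
  pose proof (whstep_not_Lam E) as L; simpl in L.
  rewrite L, E; reflexivity.
Qed.

(** * Comparison of neutral terms *)

(** Heads agree exactly, whereas arguments are compared up to [conv], so injectivity can be read off
    the relation. *)
Inductive neutral_eq : forall G T, term G T -> term G T -> Prop :=
| neutral_bvar : forall G t (m : member t G), neutral_eq (Bvar m) (Bvar m)
| neutral_fvar : forall G t (x : name t), neutral_eq (G := G) (Fvar x) (Fvar x)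
| neutral_nom : forall G t (a : name t), neutral_eq (G := G) (Nom a) (Nom a)
| neutral_cst : forall G ts r (k : const ts r), neutral_eq (G := G) (Cst k) (Cst k)
| neutral_log : forall G t (k : logical t), neutral_eq (G := G) (Log k) (Log k)
| neutral_app : forall G t u (n n' : term G (Arr t u)) a a',
    neutral_eq n n' -> conv a a' -> neutral_eq (App n a) (App n' a').

Lemma neutral_eq_sym G T (e e' : term G T) : neutral_eq e e' -> neutral_eq e' e.
Proof. induction 1; constructor; auto using conv_sym. Qed.

Lemma neutral_eq_conv G T (e e' : term G T) : neutral_eq e e' -> conv e e'.
Proof. induction 1; try apply conv_refl. apply conv_app; auto. Qed.

(** Inversion at an application equates components over an unknown argument type; through [app_view]
    the equalities are recovered from decidability of equality of types. *)
Lemma neutral_eq_view G T (e e' : term G T) : neutral_eq e e' ->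
  forall s f a, app_view e = Some (existT _ s (f, a)) ->
  exists f' a', app_view e' = Some (existT _ s (f', a')) /\ neutral_eq f f' /\ conv a a'.
Proof.
  intros H; destruct H; simpl; intros s f b E; try discriminate.
  injection E as E1 E2 E3; subst s.
  apply inj_pair2_eq_dec in E2, E3; try exact (ty_eq_dec (@base_eq_dec S)); subst.
  eauto.
Qed.

Lemma app_view_App G T (e : term G T) s f a :
  app_view e = Some (existT _ s (f, a)) -> e = App f a.
Proof.
  destruct e; simpl; intros E; try discriminate.
  injection E as E1 E2 E3; subst s.
  apply inj_pair2_eq_dec in E2, E3; try exact (ty_eq_dec (@base_eq_dec S)); subst.
  reflexivity.
Qed.

Lemma neutral_eq_App G t u (f f' : term G (Arr t u)) a a' :
  neutral_eq (App f a) (App f' a') -> neutral_eq f f' /\ conv a a'.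
Proof.
  intros H; destruct (neutral_eq_view H eq_refl) as (f1 & a1 & E & Hf & Ha).
  simpl in E; injection E as E2 E3.
  apply inj_pair2_eq_dec in E2, E3; try exact (ty_eq_dec (@base_eq_dec S)); subst.
  auto.
Qed.

Lemma neutral_eq_trans G T (e1 e2 : term G T) : neutral_eq e1 e2 ->
  forall e3, neutral_eq e2 e3 -> neutral_eq e1 e3.
Proof.
  induction 1; intros e3 H3; auto.
  destruct (neutral_eq_view H3 eq_refl) as (f1 & a1 & E & Hf & Ha).
  rewrite (app_view_App E); constructor; [auto|eapply conv_trans; eauto].
Qed.

Lemma neutral_eq_whnf G T (e e' : term G T) :
  neutral_eq e e' -> whstep e = None /\ lam_view e = lam_none G T.
Proof.
  induction 1; simpl; auto.
  destruct IHneutral_eq as [E1 E2]; simpl in E2; rewrite E1, E2; auto.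
Qed.

Lemma neutral_eq_ren G T (e e' : term G T) D (r : forall t, member t G -> member t D) :
  neutral_eq e e' -> neutral_eq (ren e r) (ren e' r).
Proof.
  intros H; revert D r; induction H; intros; simpl; constructor; auto using conv_ren.
Qed.

(** * The Kripke logical relation *)

(** At arrow types the quantification over renamings makes the relation stable under weakening,
    which lets functions be tested on a fresh variable in [lrel_reflect_reify]. *)
Fixpoint lrel (T : typ S) : forall G, term G T -> term G T -> Prop :=
  match T return forall G, term G T -> term G T -> Prop with
  | Arr t u => fun G e e' =>
      forall D (r : forall t, member t G -> member t D) a a',
        lrel a a' -> lrel (App (ren e r) a) (App (ren e' r) a')
  | _ => fun G e e' => exists n n', whred e n /\ whred e' n' /\ neutral_eq n n'
  end.

Lemma lrel_sym T G (e e' : term G T) : lrel e e' -> lrel e' e.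
Proof.
  revert G e e'; induction T; simpl; intros G e e' H.
  - destruct H as (n & n' & ? & ? & ?); exists n', n; auto using neutral_eq_sym.
  - destruct H as (n & n' & ? & ? & ?); exists n', n; auto using neutral_eq_sym.
  - intros; apply IHT2, H, IHT1; assumption.
Qed.

Lemma whred_neutral_trans G T (e1 e2 e3 : term G T) :
  (exists n n', whred e1 n /\ whred e2 n' /\ neutral_eq n n') ->
  (exists n n', whred e2 n /\ whred e3 n' /\ neutral_eq n n') ->
  exists n n', whred e1 n /\ whred e3 n' /\ neutral_eq n n'.
Proof.
  intros (n1 & n2 & R1 & R2 & N) (m2 & m3 & R2' & R3 & N').
  destruct (neutral_eq_whnf (neutral_eq_sym N)) as [W _].
  destruct (neutral_eq_whnf N') as [W' _].
  rewrite (whred_det R2 R2' W W') in N.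
  exists n1, m3; eauto using neutral_eq_trans.
Qed.

Lemma lrel_trans T G (e1 e2 e3 : term G T) : lrel e1 e2 -> lrel e2 e3 -> lrel e1 e3.
Proof.
  revert G e1 e2 e3; induction T as [b| |s IHs u IHu]; simpl; intros G e1 e2 e3.
  - apply whred_neutral_trans.
  - apply whred_neutral_trans.
  - intros H12 H23 D r a a' Ha.
    eapply IHu; [apply H12, Ha|apply H23].
    (* [a'] is related to itself by passing through [a], the relation being symmetric and transitive
       at the smaller type. *)
    eapply IHs; [apply lrel_sym, Ha|exact Ha].
Qed.

Lemma lrel_ren T G (e e' : term G T) D (r : forall t, member t G -> member t D) :
  lrel e e' -> lrel (ren e r) (ren e' r).
Proof.
  destruct T; simpl.
  - intros (n & n' & ? & ? & ?); exists (ren n r), (ren n' r);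
      auto using whred_ren, neutral_eq_ren.
  - intros (n & n' & ? & ? & ?); exists (ren n r), (ren n' r);
      auto using whred_ren, neutral_eq_ren.
  - intros H E r' a a' Ha; rewrite !ren_ren; apply H, Ha.
Qed.

Lemma lrel_expand T G (e e1 e' : term G T) :
  whstep e = Some e1 -> lrel e1 e' -> lrel e e'.
Proof.
  revert G e e1 e'; induction T; simpl; intros G e e1 e' E H.
  - destruct H as (n & n' & ? & ? & ?); exists n, n'; eauto using whred_step.
  - destruct H as (n & n' & ? & ? & ?); exists n, n'; eauto using whred_step.
  - intros; eapply IHT2; [apply whstep_App, whstep_ren, E|apply H; assumption].
Qed.

(** The two halves need each other at an arrow: related arguments must be convertible to extend a
    neutral spine, and related functions are applied to a fresh bound variable, which is neutral and
    hence related to itself, before eta concludes. *)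
Lemma lrel_reflect_reify T :
  (forall G (e e' : term G T), neutral_eq e e' -> lrel e e') /\
  (forall G (e e' : term G T), lrel e e' -> conv e e').
Proof.
  assert (K : forall T G (e e' : term G T),
    (exists n n', whred e n /\ whred e' n' /\ neutral_eq n n') -> conv e e').
  { intros T' G e e' (n & n' & R & R' & N).
    eapply conv_trans; [apply whred_conv, R|].
    eapply conv_trans; [apply neutral_eq_conv, N|].
    apply conv_sym, whred_conv, R'. }
  induction T as [b| |s [Is Rs] u [Iu Ru]]; simpl; split; auto.
  - intros G e e' H; exists e, e'; repeat split; auto; constructor.
  - intros G e e' H; exists e, e'; repeat split; auto; constructor.
  - intros G e e' H D r a a' Ha; apply Iu; constructor; auto using neutral_eq_ren.
  - intros G e e' H.
    eapply conv_trans; [apply conv_sym, conv_eta|].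
    eapply conv_trans; [|apply conv_eta].
    apply conv_lam, Ru, H, Is; constructor.
Qed.

Definition lrel_sub {G D} (h h' : forall t, member t G -> term D t) : Prop :=
  forall t (m : member t G), lrel (h t m) (h' t m).

Lemma lrel_Lam G D t u (e e' : term (t :: G) u) (h h' : forall t, member t G -> term D t) :
  (forall E (k k' : forall v, member v (t :: G) -> term E v),
     lrel_sub k k' -> lrel (bsubst e k) (bsubst e' k')) ->
  lrel_sub h h' -> lrel (bsubst (Lam e) h) (bsubst (Lam e') h').
Proof.
  intros H Hh E r a a' Ha.
  assert (K : forall (f : term (t :: G) u) (k : forall t, member t G -> term D t) b,
    whstep (App (ren (bsubst (Lam f) k) r) b) =
    Some (bsubst f (sub_cons b (fun v m => ren (k v m) r)))).
  { intros f k b; simpl; f_equal.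
    rewrite !bsubst_gsub, gsub_ren, gsub_gsub; f_equal.
    apply gs_ext; try reflexivity.
    apply member_cons_ind; [reflexivity|]; intros; simpl.
    unfold shift; rewrite gsub_ren, ren_gsub; reflexivity. }
  eapply lrel_expand; [apply K|].
  apply lrel_sym; eapply lrel_expand; [apply K|].
  apply lrel_sym, H; unfold lrel_sub; apply member_cons_ind; [exact Ha|].
  intros; apply lrel_ren, Hh.
Qed.

Lemma lrel_App G t u (f f' : term G (Arr t u)) a a' :
  lrel f f' -> lrel a a' -> lrel (App f a) (App f' a').
Proof.
  intros Hf Ha; specialize (Hf _ (fun _ m => m) _ _ Ha); rewrite !ren_id in Hf.
  exact Hf.
Qed.

(** The fundamental lemma of the relation, with two related environments. *)
Lemma lrel_refl G t (e : term G t) : forall D (h h' : forall t, member t G -> term D t),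
  lrel_sub h h' -> lrel (bsubst e h) (bsubst e h').
Proof.
  induction e; intros D h h' Hh.
  - apply Hh.
  - apply lrel_reflect_reify; constructor.
  - apply lrel_reflect_reify; constructor.
  - apply lrel_reflect_reify; constructor.
  - apply lrel_reflect_reify; constructor.
  - apply lrel_Lam; auto.
  - apply lrel_App; auto.
Qed.

(** Beta and eta are absorbed by head expansion; transitivity of [conv] uses that an environment
    related to another one is related to itself. *)
Lemma conv_lrel_sub G t (e e' : term G t) : conv e e' ->
  forall D (h h' : forall t, member t G -> term D t),
  lrel_sub h h' -> lrel (bsubst e h) (bsubst e' h').
Proof.
  induction 1; intros D h h' Hh.
  - eapply lrel_expand; [reflexivity|].
    rewrite bsubst_lift_cons.
    replace (bsubst (bsubst e _) h') with (bsubst e (sub_cons (bsubst e' h') h')).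
    { apply lrel_refl; unfold lrel_sub; apply member_cons_ind; [apply lrel_refl|]; auto. }
    rewrite !bsubst_gsub, gsub_gsub; f_equal; apply gs_ext; try reflexivity.
    apply member_cons_ind; reflexivity.
  - intros E r a a' Ha; eapply lrel_expand; [reflexivity|].
    replace (bsubst _ _) with (App (ren (bsubst e h) r) a).
    { apply lrel_App; [apply lrel_ren, lrel_refl, Hh|exact Ha]. }
    simpl; f_equal.
    rewrite !bsubst_gsub, ren_of_gsub, gsub_ren, gsub_gsub; unfold shift; rewrite gsub_ren.
    f_equal; apply gs_ext; try reflexivity.
    intros v m; simpl; unfold shift; rewrite gsub_ren, ren_gsub; reflexivity.
  - apply lrel_Lam; auto.
  - apply lrel_App; auto.
  - apply lrel_refl, Hh.
  - apply lrel_sym, IHconv; intros v m; apply lrel_sym, Hh.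
  - eapply lrel_trans; [apply IHconv1|apply IHconv2, Hh].
    intros v m; eapply lrel_trans; [apply Hh|apply lrel_sym, Hh].
Qed.

Lemma conv_lrel G t (e e' : term G t) : conv e e' -> lrel e e'.
Proof.
  intros H.
  assert (K : lrel (bsubst e (fun _ m => Bvar m)) (bsubst e' (fun _ m => Bvar m))).
  { apply conv_lrel_sub; [exact H|].
    intros v m; apply lrel_reflect_reify; constructor. }
  rewrite !bsubst_gsub, !(gsub_id (G := G)) in K; exact K.
Qed.

(** The type [target r] is never an arrow, so the relation directly compares weak head normal forms,
    and a neutral term is its own. *)
Lemma conv_neutral G r (e e' : term G (target r)) :
  conv e e' -> neutral_eq e e -> neutral_eq e' e' -> neutral_eq e e'.
Proof.
  intros H%conv_lrel [W _]%neutral_eq_whnf [W' _]%neutral_eq_whnf.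
  destruct r; destruct H as (n & n' & R & R' & N);
    rewrite <- (whred_None R W), <- (whred_None R' W'); exact N.
Qed.

(** * Injectivity of applied constants *)

Lemma neutral_eq_refl_apps G ts t (n : term G (arrs ts t)) (es : hlist (term G) ts) :
  neutral_eq n n -> neutral_eq (apps n es) (apps n es).
Proof.
  revert n; induction es; intros n H; simpl; auto.
  apply IHes; constructor; auto using conv_refl.
Qed.

Lemma neutral_eq_apps G ts t (n n' : term G (arrs ts t)) (es es' : hlist (term G) ts) :
  neutral_eq (apps n es) (apps n' es') -> neutral_eq n n' /\ hconv es es'.
Proof.
  revert n n' es'; induction es; intros n n' es' H.
  - rewrite (hlist_nil_inv es') in *; split; [exact H|constructor].
  - destruct (hlist_cons_inv es') as (e1 & es1 & ->); simpl in H.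
    destruct (IHes _ _ _ H) as [H1 H2].
    apply neutral_eq_App in H1 as [H1 H3]; split; [exact H1|constructor; assumption].
Qed.

Lemma apps_Cst_inj G ts r (k : const ts r) (es es' : hlist (term G) ts) :
  conv (apps (Cst k) es) (apps (Cst k) es') -> hconv es es'.
Proof.
  intros H; apply conv_neutral in H; try (apply neutral_eq_refl_apps; constructor).
  apply neutral_eq_apps in H; apply H.
Qed.

Lemma Log_App2_inj G t u (k : logical (Arr t (Arr u Prp))) (a a' : term G t) (b b' : term G u) :
  conv (App (App (Log k) a) b) (App (App (Log k) a') b') -> conv a a' /\ conv b b'.
Proof.
  intros H; apply (@conv_neutral G None) in H;
    try (repeat apply neutral_app; try apply conv_refl; apply neutral_log).
  apply neutral_eq_App in H as [H Hb]; apply neutral_eq_App in H as [_ Ha]; auto.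
Qed.

Lemma Log_App_inj G t (k : logical (Arr t Prp)) (a a' : term G t) :
  conv (App (Log k) a) (App (Log k) a') -> conv a a'.
Proof.
  intros H; apply (@conv_neutral G None) in H;
    try (apply neutral_app; [apply neutral_log|apply conv_refl]).
  apply neutral_eq_App in H as [_ Ha]; exact Ha.
Qed.

End Substitution.

(** * Occurrence of symbols *)

Section Occurrence.
Context {S : signature}.
Implicit Types (G D : list (typ S)) (t u : typ S) (P : @symbol S -> Prop).

(** Purging exchanges a variable and the nominal constant of the same name, so one of the two must
    lie in [P] for the exchange to lead into [P]. Ordinary constants are never replaced, so all of
    them must lie in [P]. *)
Definition admissible P : Prop :=
  (forall t (x : name t), P (SVar x) \/ P (SNom x)) /\
  (forall ts r (k : const ts r), P (SCst k)).

(* Variables and nominal constants share their names, so a variable outside [P]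
   can be turned into the nominal constant with the same name, and conversely;
   a type need not have any other inhabitant. *)
Definition purge P {G} : gs G G :=
  GS (fun _ x => if excluded_middle_informative (P (SVar x)) then Fvar x else Nom x)
     (fun _ a => if excluded_middle_informative (P (SNom a)) then Nom a else Fvar a)
     (fun _ m => Bvar m).

Definition within P {G t} (e : term G t) : Prop := conv e (gsub e (purge P)).

Lemma glift_purge P G u : glift (u := u) (purge P (G := G)) = purge P.
Proof.
  apply gs_ext; simpl.
  - intros; destruct (excluded_middle_informative _); reflexivity.
  - intros; destruct (excluded_middle_informative _); reflexivity.
  - apply member_cons_ind; reflexivity.
Qed.

Lemma glifts_purge P ts G : glifts ts (purge P (G := G)) = purge P.
Proof.
  revert G; induction ts as [|u ts IH]; intros G; simpl; [reflexivity|].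
  rewrite glift_purge; apply IH.
Qed.

Lemma written_purge P G t (e : term G t) s :
  admissible P -> written s (gsub e (purge P)) -> P s.
Proof.
  intros [HP HC]; induction e; simpl; try tauto.
  - destruct (excluded_middle_informative _); simpl; intros ->; auto.
    destruct (HP _ n); tauto.
  - destruct (excluded_middle_informative _); simpl; intros ->; auto.
    destruct (HP _ n); tauto.
  - intros ->; apply HC.
  - rewrite glift_purge; exact IHe.
Qed.

Lemma purge_ext P Q G t (e : term G t) :
  (forall s, written s e -> (P s <-> Q s)) -> gsub e (purge P) = gsub e (purge Q).
Proof.
  induction e; simpl; intros H; try reflexivity.
  - specialize (H _ eq_refl).
    do 2 destruct (excluded_middle_informative _); tauto.
  - specialize (H _ eq_refl).
    do 2 destruct (excluded_middle_informative _); tauto.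
  - rewrite !glift_purge, IHe; auto.
  - rewrite IHe1, IHe2; auto.
Qed.

Lemma purge_id P G t (e : term G t) :
  (forall s, written s e -> P s) -> gsub e (purge P) = e.
Proof.
  intros H; rewrite (@purge_ext P (fun _ => True)) by (intros; split; auto).
  rewrite <- (gsub_id e) at 2; f_equal; apply gs_ext; try reflexivity; intros; simpl;
    destruct (excluded_middle_informative _); tauto.
Qed.

Lemma written_finite G t (e : term G t) : exists l, forall s, written s e -> In s l.
Proof.
  induction e; simpl.
  - exists []; tauto.
  - exists [SVar n]; intros s ->; left; reflexivity.
  - exists [SNom n]; intros s ->; left; reflexivity.
  - exists [SCst c]; intros s ->; left; reflexivity.
  - exists []; tauto.
  - exact IHe.
  - destruct IHe1 as [l1 H1], IHe2 as [l2 H2]; exists (l1 ++ l2).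
    intros s [H|H]; apply in_or_app; auto.
Qed.

Lemma purge_purge P s l G :
  admissible P -> ~ P s ->
  gcomp (purge (fun s' => P s' \/ ~ In s' l)) (purge (fun s' => s' <> s)) =
  purge (fun s' => P s' \/ ~ In s' (s :: l)) (G := G).
Proof.
  intros [HP _] Hs; apply gs_ext; try reflexivity; intros t x; simpl.
  - destruct (excluded_middle_informative (P (SVar x) \/ ~ In (SVar x) l)) as [H|H]; simpl;
      destruct (excluded_middle_informative _) as [H1|H1];
      destruct (excluded_middle_informative _) as [H2|H2]; try reflexivity; exfalso.
    + apply H2; destruct H as [H|H]; auto.
      right; intros [->|H']; auto.
    + apply H1; intros E; destruct H2 as [H2|H2]; subst; tauto.
    + tauto.
    (* Here [s] is the nominal constant just put in place of the variable [x]; both would lie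
       outside [P], against admissibility. *)
    + apply H1; intros <-; destruct (HP _ x); tauto.
  - destruct (excluded_middle_informative (P (SNom x) \/ ~ In (SNom x) l)) as [H|H]; simpl;
      destruct (excluded_middle_informative _) as [H1|H1];
      destruct (excluded_middle_informative _) as [H2|H2]; try reflexivity; exfalso.
    + apply H2; destruct H as [H|H]; auto.
      right; intros [->|H']; auto.
    + apply H1; intros E; destruct H2 as [H2|H2]; subst; tauto.
    + tauto.
    + apply H1; intros <-; destruct (HP _ x); tauto.
Qed.

(* Purging one symbol at a time: each non-occurring symbol is missing from some
   representative, which purging it does not change. *)
Lemma within_iff P G t (e : term G t) : admissible P ->
  within P e <-> forall s, occurs s e -> P s.
Proof.
  intros HP; split.
  - intros H s Hs; apply (written_purge (e := e) HP), Hs, H.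
  - intros H.
    assert (K : forall l, conv e (gsub e (purge (fun s => P s \/ ~ In s l)))).
    { induction l as [|s l IH].
      { rewrite purge_id; [apply conv_refl|simpl; tauto]. }
      destruct (classic (P s)) as [Hs|Hs].
      { erewrite purge_ext; [exact IH|]; intros s' _; simpl; split; [tauto|].
        intros [H'|H']; [tauto|]. destruct (classic (s = s')); [subst|]; tauto. }
      assert (N : ~ occurs s e) by auto.
      apply not_all_ex_not in N as [e' N]; apply imply_to_and in N as [E N].
      rewrite <- purge_purge, <- gsub_gsub by assumption.
      eapply conv_trans; [|apply conv_gsub, IH].
      eapply conv_trans; [exact E|].
      eapply conv_trans; [|apply conv_gsub, conv_sym, E].
      rewrite purge_id; [apply conv_refl|intros s' W ->; auto]. }
    (* For an [l] containing every symbol written in [e], the alternative [~ In s l] never applies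
       to such a symbol and only [P] is left. *)
    destruct (written_finite e) as [l Hl].
    unfold within; erewrite purge_ext; [apply (K l)|].
    intros s W; specialize (Hl s W); tauto.
Qed.

Lemma within_conv P G t (e e' : term G t) : conv e e' -> within P e -> within P e'.
Proof.
  unfold within; intros E H.
  eapply conv_trans; [apply conv_sym, E|].
  eapply conv_trans; [exact H|]. apply conv_gsub, E.
Qed.

Lemma within_App P G t u (e : term G (Arr t u)) e' :
  within P e -> within P e' -> within P (App e e').
Proof. apply conv_app. Qed.

Lemma within_Lam P G t u (e : term (t :: G) u) : within P e -> within P (Lam e).
Proof. unfold within; simpl; rewrite glift_purge; apply conv_lam. Qed.

Lemma within_lams P ts G t (e : term (rev_append ts G) t) :
  within P e <-> within P (lams e).
Proof.
  unfold within; rewrite gsub_lams, glifts_purge.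
  split; [apply conv_lams|apply lams_inj].
Qed.

Lemma within_ren P G t (e : term G t) D (r : forall t, member t G -> member t D) :
  within P e -> within P (ren e r).
Proof.
  unfold within; intros H; rewrite gsub_ren.
  replace (gsub e _) with (ren (gsub e (purge P)) r).
  { apply conv_ren, H. }
  rewrite ren_of_gsub; f_equal; apply gs_ext; try reflexivity; intros; simpl;
    destruct (excluded_middle_informative _); reflexivity.
Qed.

Lemma within_bsubst P G t (e : term G t) D (h : forall t, member t G -> term D t) :
  within P e -> (forall t (m : member t G), within P (h t m)) -> within P (bsubst e h).
Proof.
  unfold within; intros H Hh.
  replace (gsub (bsubst e h) (purge P))
    with (bsubst (gsub e (purge P)) (fun t m => gsub (h t m) (purge P))).
  - eapply conv_trans; [apply bsubst_conv, Hh|]. apply conv_bsubst, H.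
  - rewrite !bsubst_gsub, !gsub_gsub; f_equal; apply gs_ext; try reflexivity;
      intros; simpl; destruct (excluded_middle_informative _); reflexivity.
Qed.

Fixpoint hwithin P {G ts} (es : hlist (term G) ts) : Prop :=
  match es with
  | hnil => True
  | hcons e es' => within P e /\ hwithin P es'
  end.

Lemma within_apps P G ts t (e : term G (arrs ts t)) (es : hlist (term G) ts) :
  within P e -> hwithin P es -> within P (apps e es).
Proof.
  revert e; induction es; simpl; intros e He Hes; auto.
  apply IHes; [apply within_App|]; tauto.
Qed.

Definition hhead {A : Type} {F : A -> Type} {a l} (h : hlist F (a :: l)) : F a :=
  match h in hlist _ l0 return match l0 with [] => unit | b :: _ => F b end with
  | hnil => tt
  | hcons x _ => x
  end.

Definition htail {A : Type} {F : A -> Type} {a l} (h : hlist F (a :: l)) : hlist F l :=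
  match h in hlist _ l0 return match l0 with [] => unit | _ :: l' => hlist F l' end with
  | hnil => tt
  | hcons _ h' => h'
  end.

Lemma hconv_cons_inv G t ts (es es' : hlist (term G) (t :: ts)) :
  hconv es es' -> conv (hhead es) (hhead es') /\ hconv (htail es) (htail es').
Proof.
  intros H.
  refine (match H in @hconv _ _ l a b return
    match l as l0 return hlist (term G) l0 -> hlist (term G) l0 -> Prop with
    | [] => fun _ _ => True
    | t :: ts => fun a b => conv (hhead a) (hhead b) /\ hconv (htail a) (htail b)
    end a b with
    | hconv_nil => I
    | hconv_cons E Es => Logic.conj E Es
    end).
Qed.

Lemma hwithin_hconv P G ts (es : hlist (term G) ts) :
  hwithin P es <-> hconv es (hmap (fun _ e => gsub e (purge P)) es).
Proof.
  induction es as [|t ts e es IH]; simpl.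
  - split; [constructor|tauto].
  - rewrite IH; split.
    + intros [? ?]; constructor; assumption.
    + intros H%hconv_cons_inv; exact H.
Qed.

(** Purging leaves the head alone, so injectivity of applied constants passes the conversion on to
    the arguments. *)
Lemma within_apps_Cst P G ts r (k : const ts r) (es : hlist (term G) ts) :
  within P (apps (Cst k) es) <-> hwithin P es.
Proof.
  split.
  - unfold within; rewrite gsub_apps; intros H%apps_Cst_inj; apply hwithin_hconv, H.
  - apply within_apps, conv_refl.
Qed.

Lemma within_Log_App2 P G t u (k : logical (Arr t (Arr u Prp))) (a : term G t) (b : term G u) :
  within P (App (App (Log k) a) b) <-> within P a /\ within P b.
Proof.
  split; [apply Log_App2_inj|].
  intros [Ha Hb]; repeat apply within_App; auto; apply conv_refl.
Qed.

Lemma within_Log_App P G t (k : logical (Arr t Prp)) (a : term G t) :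
  within P (App (Log k) a) <-> within P a.
Proof.
  split; [apply Log_App_inj|].
  intros Ha; apply within_App; auto; apply conv_refl.
Qed.

Lemma within_ext P G D ts (es : hlist (term D) ts) (h : forall t, member t G -> term D t) :
  hwithin P es -> (forall t (m : member t G), within P (h t m)) ->
  forall t (m : member t (rev_append ts G)), within P (ext h es m).
Proof.
  revert G h; induction es; simpl; intros G h Hes Hh; auto.
  apply IHes; [tauto|]. apply member_cons_ind; simpl; tauto.
Qed.

Lemma hwithin_bound_vars P ts G : hwithin P (bound_vars ts G).
Proof.
  revert G; induction ts; simpl; intros; split; auto; apply conv_refl.
Qed.

Lemma hwithin_ren P G D ts (es : hlist (term G) ts) (r : forall t, member t G -> member t D) :
  hwithin P es -> hwithin P (hmap (fun _ e => ren e r) es).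
Proof. induction es; simpl; auto. intros [? ?]; auto using within_ren. Qed.

Lemma hwithin_all P G ts (es : hlist (term G) ts) :
  (forall e, In e (hto_list es) -> within P (projT2 e)) -> hwithin P es.
Proof.
  induction es; simpl; intros H; auto.
  split; [apply (H (existT _ _ f)); auto|auto].
Qed.

Lemma closed_within P G t (e : term G t) :
  admissible P -> closed e -> nominal_free e -> within P e.
Proof.
  intros HP Hc Hn; apply within_iff; [exact HP|].
  intros [u x|u a|us r k] H; [destruct (Hc u x H)|destruct (Hn u a H)|apply HP].
Qed.

(** * Free variables and support *)

(** Only one sort of symbols is restricted, here and in [noms_in], so of a variable and a nominal
    constant with the same name one is always accepted, as admissibility demands. *)
Definition vars_in (V : @varset S) (s : @symbol S) : Prop :=
  match s with SVar x => V _ x | _ => True end.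

Definition noms_in (N : forall t : typ S, name t -> Prop) (s : @symbol S) : Prop :=
  match s with SNom a => N _ a | _ => True end.

Lemma vars_in_admissible V : admissible (vars_in V).
Proof. split; simpl; auto. Qed.

Lemma noms_in_admissible N : admissible (noms_in N).
Proof. split; simpl; auto. Qed.

Lemma fv_within V G t (e : term G t) :
  (forall u (x : name u), fv e x -> V u x) <-> within (vars_in V) e.
Proof.
  rewrite within_iff by apply vars_in_admissible; split.
  - intros H [u x|u a|us r k] Hs; simpl; auto.
  - intros H u x Hx; apply (H (SVar x) Hx).
Qed.

Lemma supp_within N G t (e : term G t) :
  (forall u (a : name u), supp e a -> N u a) <-> within (noms_in N) e.
Proof.
  rewrite within_iff by apply noms_in_admissible; split.
  - intros H [u x|u a|us r k] Hs; simpl; auto.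
  - intros H u x Hx; apply (H (SNom x) Hx).
Qed.

Definition listed {us : list (typ S)} (cs : hlist name us) : forall t, name t -> Prop :=
  fun t a => In (existT name t a) (hto_list cs).

(** The support is the least [N] with [within (noms_in N) e]; in this form it can be moved along the
    closure properties of [within]. *)
Lemma lists_supp_within us (cs : hlist name us) G t (e : term G t) :
  lists_supp cs e <->
  NoDup (hto_list cs) /\ within (noms_in (listed cs)) e /\
  (forall N, within (noms_in N) e -> forall u (a : name u), listed cs a -> N u a).
Proof.
  split; intros [H1 H2]; split; auto.
  - split.
    + apply supp_within; intros; apply H2; assumption.
    + intros N HN u a Ha; apply (proj2 (supp_within _ _) HN), H2, Ha.
  - destruct H2 as [H2 H3]; intros u a; split.
    + intros Ha; apply (proj2 (supp_within _ _) H2 u a Ha).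
    + apply (H3 (@supp S G t e)), supp_within; auto.
Qed.

(** Up to conversion all variables of [e] are purged, and on such a term [theta] has nothing to act
    on. *)
Lemma fsubst_closed (theta : subst) G t (e : term G t) :
  closed e -> conv (fsubst theta e) e.
Proof.
  intros H.
  assert (W : within (vars_in (fun _ _ => False)) e).
  { apply fv_within; intros u x Hx; exact (H u x Hx). }
  rewrite fsubst_gsub.
  eapply conv_trans; [apply conv_gsub, W|].
  eapply conv_trans; [|apply conv_sym, W].
  rewrite gsub_gsub.
  replace (gcomp _ _) with (purge (vars_in (fun _ _ => False)) (G := G)).
  { apply conv_refl. }
  apply gs_ext; try reflexivity; intros; simpl;
    destruct (excluded_middle_informative _); try tauto; reflexivity.
Qed.

Lemma conv_abs_noms us t (cs : hlist name us) (e e' : @term S [] t) :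
  conv e e' -> conv (abs_noms cs e) (abs_noms cs e').
Proof.
  intros H; induction cs; simpl; auto.
  rewrite !bind_nom_gsub; apply conv_lam, conv_gsub, conv_ren, IHcs.
Qed.

Lemma written_ren u (x : name u) G t (e : term G t) D (r : forall t, member t G -> member t D) :
  written (SVar x) (ren e r) -> written (SVar x) e.
Proof.
  revert D r; induction e; intros D w; simpl; eauto.
  intros [H|H]; eauto.
Qed.

Lemma written_bind_nom u (x : name u) v (a : name v) G t (e : term G t) (m : member v G) :
  written (SVar x) (bind_nom a e m) -> written (SVar x) e.
Proof.
  revert m; induction e; intros w; simpl; eauto.
  - destruct (ty_eq_dec _ _ _) as [E|]; [destruct (Nat.eq_dec _ _)|]; simpl; tauto.
  - intros [H|H]; eauto.
Qed.

Lemma written_abs_noms u (x : name u) us t (cs : hlist name us) (e : @term S [] t) :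
  written (SVar x) (abs_noms cs e) -> written (SVar x) e.
Proof.
  induction cs; simpl; auto.
  intros H%written_bind_nom%written_ren; auto.
Qed.

(** Purging does not commute with [abs_noms], because a variable turned into a nominal constant
    might be captured. Instead, each representative [e'] of [e] yields the representative
    [abs_noms cs e'], in which no new variable is written. *)
Lemma within_abs_noms V us t (cs : hlist name us) (e : @term S [] t) :
  within (vars_in V) e -> within (vars_in V) (abs_noms cs e).
Proof.
  rewrite <- !fv_within; intros H u x Hx; apply H.
  intros e' He'; apply (@written_abs_noms _ _ _ _ cs), Hx, conv_abs_noms, He'.
Qed.

End Occurrence.

(** * Derived rules *)

Section Rules.
Context {S : signature}.
Implicit Types (G : list (typ S)) (t u : typ S) (V : @varset S) (D : list (@clause S))
  (Gamma : list (form S)) (A B C : form S).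

Lemma Forall2_conv_refl Gamma : Forall2 (@conv S [] Prp) Gamma Gamma.
Proof. induction Gamma; constructor; auto using conv_refl. Qed.

Lemma provable_conv_left D V Gamma A A' C :
  conv A A' -> provable D V (A :: Gamma) C -> provable D V (A' :: Gamma) C.
Proof.
  intros E; apply p_conv with (Gamma0 := A :: Gamma);
    auto using Forall2_conv_refl, conv_refl, Permutation_refl, Forall2_cons; tauto.
Qed.

Lemma provable_conv_right D V Gamma C C' :
  conv C C' -> provable D V Gamma C -> provable D V Gamma C'.
Proof.
  intros E; apply p_conv with (Gamma0 := Gamma);
    auto using Forall2_conv_refl, Permutation_refl; tauto.
Qed.

Lemma provable_perm D V V' Gamma Gamma' C :
  (forall t (x : name t), V t x <-> V' t x) -> Permutation Gamma Gamma' ->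
  provable D V Gamma C -> provable D V' Gamma' C.
Proof.
  intros HV HG; apply p_conv with (Gamma0 := Gamma');
    auto using Forall2_conv_refl, conv_refl.
Qed.

Lemma sequent_ok_within V Gamma C :
  sequent_ok V Gamma C <->
  finite V /\ within (vars_in V) C /\ Forall (within (vars_in V)) Gamma.
Proof.
  unfold sequent_ok; rewrite Forall_forall; split.
  - intros [H1 H2]; split; [exact H1|split; [|intros A HA]];
      apply fv_within; intros; eapply H2; simpl; eauto.
  - intros (H1 & H2 & H3); split; [exact H1|].
    intros A [<-|HA]; apply fv_within; auto.
Qed.

Lemma sequent_ok_cons V Gamma A C :
  sequent_ok V (A :: Gamma) C <-> within (vars_in V) A /\ sequent_ok V Gamma C.
Proof. rewrite !sequent_ok_within, Forall_cons_iff; tauto. Qed.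

Lemma within_vars_mono V V' G t (e : term G t) :
  (forall t (x : name t), V t x -> V' t x) ->
  within (vars_in V) e -> within (vars_in V') e.
Proof. rewrite <- !fv_within; auto. Qed.

(** Every rule except [p_conv] carries the condition as a premise; [p_conv] preserves it because
    occurrence is invariant under conversion. *)
Lemma provable_sequent_ok D V Gamma C : provable D V Gamma C -> sequent_ok V Gamma C.
Proof.
  induction 1 as [V V' Gamma Gamma0 Gamma' C C' HV HG HG' HC _ IH| | | | | | | | | | | | | | | | | | | | | | | | |];
    try assumption.
  rewrite sequent_ok_within in *; destruct IH as ([l Hl] & H2 & H3).
  assert (M : forall A, within (vars_in V) A -> within (vars_in V') A).
  { intros A; apply within_vars_mono; intros; apply HV; assumption. }
  split; [|split].
  - exists l; intros t x Hx; apply Hl, HV, Hx.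
  - eapply within_conv; eauto.
  - eapply Permutation_Forall in H3; [|exact HG].
    clear - H3 HG' M; induction HG'; constructor; inversion_clear H3; auto.
    eapply within_conv; eauto.
Qed.

Lemma provable_disj_list_left D V Gamma (As : list (form S)) C :
  sequent_ok V Gamma C -> (forall A, In A As -> provable D V (A :: Gamma) C) ->
  provable D V (disj_list As :: Gamma) C.
Proof.
  intros H; induction As as [|A As IH]; intros HA.
  - apply p_botL, sequent_ok_cons; split; [apply conv_refl|exact H].
  - assert (H1 : provable D V (A :: Gamma) C) by (apply HA; left; reflexivity).
    destruct As as [|B As]; [exact H1|].
    assert (H2 : provable D V (disj_list (B :: As) :: Gamma) C)
      by (apply IH; intros; apply HA; right; assumption).
    apply p_disjL; [|exact H1|exact H2].
    apply sequent_ok_cons; split; [|exact H].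
    apply provable_sequent_ok, sequent_ok_cons in H1, H2.
    apply within_Log_App2; tauto.
Qed.

Lemma within_disj_list P (As : list (form S)) :
  Forall (within P) As -> within P (disj_list As).
Proof.
  induction 1 as [|A As HA HAs IH]; [apply conv_refl|].
  destruct As as [|B As]; [exact HA|]. apply within_Log_App2; auto.
Qed.

Lemma provable_disj_list_right D V Gamma (As : list (form S)) A :
  In A As -> Forall (within (vars_in V)) As -> provable D V Gamma A ->
  provable D V Gamma (disj_list As).
Proof.
  intros HA HAs HP; induction As as [|B As IH]; [contradiction|].
  destruct As as [|B' As]; [destruct HA as [->|[]]; exact HP|].
  assert (Hok : sequent_ok V Gamma (disj B (disj_list (B' :: As)))).
  { pose proof (provable_sequent_ok HP) as H; rewrite sequent_ok_within in *.
    split; [apply H|split; [|apply H]]. apply (within_disj_list HAs). }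
  inversion_clear HAs as [|? ? HB HAs'].
  destruct HA as [->|HA]; [apply p_disjR1; assumption|].
  apply p_disjR2; auto.
Qed.

Lemma within_exists_list P xs (H : forallb o_free xs = true) G
  (A : term (rev_append xs G) Prp) : within P A -> within P (exists_list H A).
Proof.
  revert H G A; induction xs as [|u xs IH]; simpl; intros H G A HA; [exact HA|].
  apply within_Log_App, within_Lam, IH, HA.
Qed.

Lemma exists_list_body_conv xs (H : forallb o_free xs = true) G u
  (A : term (rev_append xs (u :: G)) Prp) (h : forall t, member t G -> term [] t) e :
  conv (App (Lam (bsubst (exists_list H A) (sub_lift h))) e)
       (bsubst (exists_list H A) (sub_cons e h)).
Proof. eapply conv_trans; [apply conv_beta|]. rewrite bsubst_lift_cons; apply conv_refl. Qed.

Lemma within_exists_list_inst P xs (H : forallb o_free xs = true) G u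
  (A : term (rev_append xs (u :: G)) Prp) (h : forall t, member t G -> term [] t)
  (Hu : forallb o_free (u :: xs) = true) e :
  within P (bsubst (exists_list (xs := u :: xs) Hu A) h) -> within P e ->
  within P (bsubst (exists_list H A) (sub_cons e h)).
Proof.
  intros HA He; apply (proj1 (within_Log_App _ _ _)) in HA.
  (* The two proofs that the remaining types are free of [o] are identified, equality of booleans
     being decidable. *)
  rewrite (UIP_dec Bool.bool_dec H (proj2 (andb_prop _ _ Hu))).
  eapply within_conv; [apply exists_list_body_conv|].
  apply within_App; assumption.
Qed.

(** A bound on a quantified formula is handed down to its instances one quantifier at a time, by
    injectivity of the logical constants. *)
Lemma within_exists_list_inv P xs (H : forallb o_free xs = true) G
  (A : term (rev_append xs G) Prp) (h : forall t, member t G -> term [] t)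
  (es : hlist (term []) xs) :
  within P (bsubst (exists_list H A) h) -> hwithin P es -> within P (bsubst A (ext h es)).
Proof.
  revert H G A h; induction es as [|u xs e es IH]; intros H G A h HA Hes; [exact HA|].
  simpl in Hes |- *; eapply IH; [|apply Hes].
  eapply within_exists_list_inst; [exact HA|apply Hes].
  Unshelve. exact (proj2 (andb_prop _ _ H)).
Qed.

Lemma provable_exists_list_right D V Gamma xs (H : forallb o_free xs = true) G
  (A : term (rev_append xs G) Prp) (h : forall t, member t G -> term [] t)
  (es : hlist (term []) xs) :
  within (vars_in V) (bsubst (exists_list H A) h) -> hwithin (vars_in V) es ->
  provable D V Gamma (bsubst A (ext h es)) ->
  provable D V Gamma (bsubst (exists_list H A) h).
Proof.
  intros HA Hes HP; pose proof (provable_sequent_ok HP) as Hok.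
  revert H G A h HA HP Hok; induction es as [|u xs e es IH]; intros H G A h HA HP Hok;
    [exact HP|].
  destruct Hes as [He Hes].
  apply p_existsR with (e := e).
  - rewrite sequent_ok_within in *; tauto.
  - apply fv_within, He.
  - eapply provable_conv_right; [apply conv_sym, exists_list_body_conv|].
    apply IH; auto.
    eapply within_exists_list_inst; eassumption.
Qed.

(** Witnesses that bring in no nominal constant. Free variables are taken because a type may have no
    closed inhabitant; the index 0 is arbitrary. *)
Fixpoint default_vars (xs : list (typ S)) :
  forallb o_free xs = true -> hlist (@term S []) xs :=
  match xs return forallb o_free xs = true -> hlist (@term S []) xs with
  | [] => fun _ => hnil
  | u :: xs' => fun H =>
      let H' := andb_prop _ _ H in
      hcons (Fvar (Name 0 (proj1 H'))) (default_vars (proj2 H'))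
  end.

Lemma hwithin_default_vars N xs (H : forallb o_free xs = true) :
  hwithin (noms_in N) (default_vars H).
Proof.
  induction xs; simpl; auto; split; auto.
  apply supp_within; intros u a' Ha; specialize (Ha _ (conv_refl _)); discriminate.
Qed.

Lemma hwithin_noms P us (cs : hlist name us) :
  (forall t (a : name t), listed cs a -> P (SNom a)) -> hwithin P (noms cs).
Proof.
  unfold listed, noms; induction cs as [|u us a cs IH]; simpl; intros H; auto.
  split; [|apply IH; auto].
  unfold within; rewrite purge_id; [apply conv_refl|].
  simpl; intros s ->; apply H; left; reflexivity.
Qed.

Lemma finite_varset_add V u (h : name u) : finite V -> finite (varset_add V h).
Proof.
  intros [l Hl]; exists (existT _ u h :: l).
  intros t x [H|[H|[]]]; [right; auto|left; exact H].
Qed.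

(** The rule for one quantifier demands at every stage that the support be exactly [cs]. Nothing is
    added, since each new variable is applied to [cs] only; nothing is lost, since every instance of
    the matrix is assumed to contain all of [cs]. That assumption is quantified over [es] so as to
    survive instantiation. *)
Lemma provable_exists_list_left D xs (H : forallb o_free xs = true) us (cs : hlist name us) :
  NoDup (hto_list cs) ->
  forall V Gamma C G (A : term (rev_append xs G) Prp)
    (h : forall t, member t G -> term [] t) (hs : hlist name (map (arrs us) xs)),
  sequent_ok V (bsubst (exists_list H A) h :: Gamma) C ->
  within (noms_in (listed cs)) (bsubst (exists_list H A) h) ->
  (forall N es, within (noms_in N) (bsubst A (ext h es)) ->
    forall u (a : name u), listed cs a -> N u a) ->
  NoDup (hto_list hs) -> (forall t (x : name t), var_list hs x -> ~ V t x) ->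
  provable D (varset_union V (var_list hs)) (bsubst A (ext h (raised cs hs)) :: Gamma) C ->
  provable D V (bsubst (exists_list H A) h :: Gamma) C.
Proof.
  intros Hcs; induction xs as [|u xs IH]; intros V Gamma C G A h hs Hok Hin Hout Hhs HV HP.
  - rewrite (hlist_nil_inv hs) in *.
    eapply provable_perm; [|apply Permutation_refl|exact HP].
    unfold varset_union, var_list; simpl; tauto.
  - simpl in hs; destruct (hlist_cons_inv hs) as (x & hs' & ->).
    simpl in Hhs; inversion_clear Hhs as [|? ? Hx Hhs'].
    set (e := apps (Fvar x) (noms cs)).
    assert (We : within (noms_in (listed cs)) e).
    { apply within_apps; [|apply hwithin_noms; auto].
      unfold within; rewrite purge_id; [apply conv_refl|]; simpl; intros s ->; exact I. }
    assert (We' : within (vars_in (varset_add V x)) e).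
    { apply within_apps; [|apply hwithin_noms; simpl; auto].
      unfold within; rewrite purge_id; [apply conv_refl|]; simpl; intros s ->.
      right; left; reflexivity. }
    apply p_existsL with (cs := cs) (h := x).
    + exact Hok.
    + apply lists_supp_within; split; [exact Hcs|split].
      * apply (proj1 (within_Log_App _ _ _) Hin).
      (* Minimality at an intermediate stage: the outstanding quantifiers are filled with terms
         without nominal constants, so a bound for the quantified formula also bounds an instance of
         the matrix. *)
      * intros N HN; apply (Hout N (default_vars H)).
        apply within_exists_list_inv with (H := H); [|apply hwithin_default_vars].
        apply (proj2 (within_Log_App _ (Ex (proj1 (andb_prop _ _ H))) _) HN).
    + apply HV; left; reflexivity.
    + eapply provable_conv_left; [apply conv_sym, exists_list_body_conv|].
      apply IH with (hs := hs').
      * apply sequent_ok_cons; apply sequent_ok_cons in Hok as [W Hok]; split.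
        -- eapply within_exists_list_inst; [|exact We'].
           eapply within_vars_mono; [|exact W]. left; assumption.
        -- rewrite sequent_ok_within in *; destruct Hok as (F & WC & WG).
           split; [apply finite_varset_add, F|split].
           ++ eapply within_vars_mono; [|exact WC]; left; assumption.
           ++ eapply Forall_impl; [|exact WG]; intros B; apply within_vars_mono.
              left; assumption.
      * eapply within_exists_list_inst; [exact Hin|exact We].
      * intros N es; apply (Hout N (hcons e es)).
      * exact Hhs'.
      (* The remaining eigenvariables are fresh for [x] as well, since the list of names has no
         repetition. *)
      * intros t y Hy [Hy'|[E|[]]].
        -- revert Hy'; apply HV; right; exact Hy.
        -- apply Hx; rewrite E; exact Hy.
      * eapply provable_perm; [|apply Permutation_refl|exact HP].
        unfold varset_add, varset_union, var_list; simpl; tauto.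
Qed.

End Rules.

(** * The translated clause *)

Section Translation.
Context {S : signature}.
Implicit Types (V : @varset S) (ts us : list (typ S)).

(* [Prp] is only convertible to [target None], which unification fails to guess. *)
Lemma within_atom P ts (p : const ts None) (es : hlist (@term S []) ts) :
  within P (apps (Cst p) es : form S) <-> hwithin P es.
Proof. exact (within_apps_Cst P p es). Qed.

(** * Independence of the head constant *)

(** The order of the quantifiers is the point: the abstracted arguments [es'] are chosen before the
    constant, so [p] and [p'] share them. *)
Lemma abs_noms_apps us (cs : hlist name us) ts (es : hlist (@term S []) ts) :
  exists es' : hlist (term (rev_append us [])) ts, forall r (k : const ts r),
    abs_noms cs (apps (Cst k) es) = lams (apps (Cst k) es').
Proof.
  induction cs as [|u us a cs [es1 IH]]; [exists es; reflexivity|].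
  eexists; intros r k; simpl; rewrite IH, bind_nom_gsub.
  unfold shift; rewrite ren_gsub, !gsub_lams, !gsub_apps; simpl; reflexivity.
Qed.

Lemma pc_head_inst ts (c : pclause ts) (es : hlist (@term S []) (pc_xs c)) :
  exists es' : hlist (term (rev_append (pc_zs c) [])) ts, forall r (k : const ts r),
    conv (apps (pc_head k c) es) (lams (apps (Cst k) es')).
Proof.
  eexists; intros r k; unfold pc_head.
  rewrite <- (gsub_id (lams (lams (apps (Cst k) (pc_args c))))).
  unfold gid; rewrite <- bsubst_gsub.
  eapply conv_trans; [apply apps_lams|].
  rewrite bsubst_gsub, gsub_lams, gsub_apps; apply conv_refl.
Qed.

(** Stripping the abstractions and the constant by injectivity leaves a conversion between
    arguments, to which any other constant can be applied. *)
Lemma nabs_holds_head ts (zs : list (typ S)) (es1 : hlist (term (rev_append zs [])) ts)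
  (es : hlist (@term S []) ts) r (k : const ts r) r' (k' : const ts r') :
  nabs_holds (ts := zs) (lams (apps (Cst k) es1)) (apps (Cst k) es) ->
  nabs_holds (ts := zs) (lams (apps (Cst k') es1)) (apps (Cst k') es).
Proof.
  intros (cs & Hcs & H); exists cs; split; [exact Hcs|].
  destruct (abs_noms_apps cs es) as [es2 E]; rewrite E in H |- *.
  apply conv_lams, conv_apps; [apply conv_refl|].
  apply lams_inj, apps_Cst_inj in H; exact H.
Qed.

Lemma nabs_holds_conv ts t (e1 e2 : @term S [] (arrs ts t)) (e : term [] t) :
  conv e1 e2 -> nabs_holds (ts := ts) e1 e -> nabs_holds (ts := ts) e2 e.
Proof.
  intros E (cs & Hcs & H); exists cs; split; [exact Hcs|].
  eapply conv_trans; [apply conv_sym, E|exact H].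
Qed.

(** An arbitrary [s] covers both uses: the identity in the right rule, and a permutation followed by
    [theta] in solutions. *)
Lemma nabs_holds_pc_head ts (c : pclause ts) (rs : hlist (@term S []) (pc_xs c))
  (es : hlist (term []) ts) (s : gs [] []) r (k : const ts r) r' (k' : const ts r') :
  nabs_holds (ts := pc_zs c) (gsub (apps (pc_head k c) rs) s) (gsub (apps (Cst k) es) s) ->
  nabs_holds (ts := pc_zs c) (gsub (apps (pc_head k' c) rs) s) (gsub (apps (Cst k') es) s).
Proof.
  destruct (pc_head_inst rs) as [es1 E]; rewrite !gsub_apps with (e := Cst _); simpl.
  intros H; eapply nabs_holds_conv in H; [|apply conv_gsub, E].
  eapply nabs_holds_conv; [apply conv_sym, conv_gsub, E|].
  rewrite gsub_lams, gsub_apps in H |- *; revert H; apply nabs_holds_head.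
Qed.

Lemma within_nabs_head P ts (c : pclause ts) (rs : hlist (@term S []) (pc_xs c))
  (es : hlist (term []) ts) r (k : const ts r) r' (k' : const ts r') :
  within P (nabs (ts := pc_zs c) (apps (pc_head k c) rs) (apps (Cst k) es)) ->
  within P (nabs (ts := pc_zs c) (apps (pc_head k' c) rs) (apps (Cst k') es)).
Proof.
  destruct (pc_head_inst rs) as [es1 E].
  intros [H1 H2]%within_Log_App2; apply within_Log_App2; split.
  - eapply within_conv; [apply conv_sym, E|].
    eapply within_conv in H1; [|apply E].
    apply -> (@within_lams S); apply within_lams in H1.
    apply within_apps_Cst in H1; apply within_apps_Cst, H1.
  - apply within_apps_Cst in H2; apply within_apps_Cst, H2.
Qed.

Lemma solution_pc_head (theta : subst) ts (c : pclause ts)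
  (rs : hlist (@term S []) (pc_xs c)) (es : hlist (term []) ts)
  r (k : const ts r) r' (k' : const ts r') :
  solution theta (ts := pc_zs c) (apps (pc_head k c) rs) (apps (Cst k) es) ->
  solution theta (ts := pc_zs c) (apps (pc_head k' c) rs) (apps (Cst k') es).
Proof.
  intros (pi & Ha & H); exists pi; split.
  (* The side condition on [pi] depends on the support only, which is unchanged when the head
     constant is exchanged. *)
  - intros u a Hs; apply Ha; clear Ha H.
    revert u a Hs; apply supp_within.
    apply within_nabs_head with (k := k), supp_within; auto.
  - rewrite !fsubst_gsub, !pact_gsub, !gsub_gsub in H |- *.
    revert H; apply nabs_holds_pc_head.
Qed.

(** * Instances of the translated clause *)

(** The part of [pc_disjunct] under its quantifiers, isolated so that the lemmas on [exists_list]
    apply to it by computation. *)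
Definition pc_matrix {ts r} (p' : const ts r) (c : pclause ts) :
  term (rev_append (pc_xs c) (rev_append ts [arrs ts Prp])) Prp :=
  conj
    (nabs (apps (weaken (pc_head p' c)) (bound_vars (pc_xs c) _))
          (apps (Cst p')
            (hmap (fun _ e => ren e (fun _ m => member_under m)) (bound_vars ts _))))
    (apps (App (weaken (pc_body c)) (Bvar (member_under (member_under MZ))))
          (bound_vars (pc_xs c) _)).

Definition inst_pred {ts} (p : const ts None) (es : hlist (@term S []) ts) :
  forall t, member t (rev_append ts [arrs ts Prp]) -> term [] t :=
  ext (sub_cons (Cst p) (fun _ m => Bvar m)) es.

Lemma pc_matrix_inst ts r (p : const ts None) (p' : const ts r) (c : pclause ts)
  (es : hlist (@term S []) ts) (rs : hlist (term []) (pc_xs c)) :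
  bsubst (pc_matrix p' c) (ext (inst_pred p es) rs) =
  conj (nabs (ts := pc_zs c) (apps (pc_head p' c) rs) (apps (Cst p') es)) (pc_inst p c rs).
Proof.
  unfold pc_matrix, conj, nabs, pc_inst; simpl.
  rewrite !bsubst_apps; simpl; rewrite !bsubst_weaken, !bsubst_bound_vars.
  rewrite ext_member_under; unfold inst_pred at 2; rewrite ext_member_under; simpl.
  do 4 f_equal.
  rewrite hmap_hmap, <- (bsubst_bound_vars es (sub_cons (Cst p) (fun _ m => Bvar m))) at 1.
  apply hmap_ext; intros t e; rewrite !bsubst_gsub, gsub_ren; f_equal.
  apply gs_ext; try reflexivity; intros; simpl; apply ext_member_under.
Qed.

Lemma bsubst_disj_list G D (As : list (@term S G Prp)) (h : forall t, member t G -> term D t) :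
  bsubst (disj_list As) h = disj_list (map (fun A => bsubst A h) As).
Proof.
  induction As as [|A As IH]; [reflexivity|].
  destruct As as [|B As]; [reflexivity|].
  change (disj (bsubst A h) (bsubst (disj_list (B :: As)) h) =
          disj (bsubst A h) (disj_list (map (fun A => bsubst A h) (B :: As)))).
  rewrite IH; reflexivity.
Qed.

Lemma translate_unfold ts r (p : const ts None) (p' : const ts r) (pcs : list (pclause ts))
  (es : hlist (@term S []) ts) :
  conv (apps (App (cl_body (translate p p' pcs)) (Cst p)) es)
       (disj_list (map (fun c => bsubst (pc_disjunct p' c) (inst_pred p es)) pcs)).
Proof.
  simpl; eapply conv_trans; [apply conv_apps; [apply conv_beta|apply hconv_refl]|].
  eapply conv_trans; [apply apps_lams|].
  rewrite bsubst_disj_list, map_map; apply conv_refl.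
Qed.

Lemma hwithin_raised V us (cs : hlist name us) xs (hs : hlist name (map (arrs us) xs)) :
  (forall t (x : name t), var_list hs x -> V t x) ->
  hwithin (vars_in V) (raised cs hs).
Proof.
  induction xs as [|u xs IH]; simpl in hs; intros H.
  - rewrite (hlist_nil_inv hs); exact I.
  - destruct (hlist_cons_inv hs) as (x & hs' & ->); split.
    + apply within_apps; [|apply hwithin_noms; simpl; auto].
      unfold within; rewrite purge_id; [apply conv_refl|]; simpl; intros s ->.
      apply H; left; reflexivity.
    + apply IH; intros t y Hy; apply H; right; exact Hy.
Qed.

Lemma sequent_ok_union V us (hs : hlist name us) Gamma C :
  sequent_ok V Gamma C -> sequent_ok (varset_union V (var_list hs)) Gamma C.
Proof.
  intros [[l Hl] H]; split.
  - exists (l ++ hto_list hs); intros t x [Hx|Hx]; apply in_or_app; auto.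
  - intros A HA t x Hx; left; eauto.
Qed.

(** * Admissibility of the two pattern rules *)

Section Clauses.
Context (lvl : @level_map S) (ts : list (typ S)) (r : option (base S)).
Context (p : @const S ts None) (p' : @const S ts r) (pcs : list (pclause ts)).
Context (Hpcs : pclauses_ok lvl p pcs).

Lemma within_pc_head P c r' (k : const ts r') :
  admissible P -> In c pcs -> within P (pc_head k c).
Proof.
  intros HP Hc; destruct (Hpcs Hc) as [Ha _].
  apply -> (@within_lams S); apply -> (@within_lams S).
  apply within_apps_Cst, hwithin_all.
  intros e He; apply closed_within; [exact HP| |]; apply (Ha e He).
Qed.

Lemma within_pc_body P c : admissible P -> In c pcs -> within P (pc_body c).
Proof.
  intros HP Hc; destruct (Hpcs Hc) as (_ & _ & H1 & H2 & _).
  apply closed_within; assumption.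
Qed.

Lemma within_pc_disjunct P c (es : hlist (term []) ts) :
  admissible P -> In c pcs -> hwithin P es ->
  within P (bsubst (pc_disjunct p' c) (inst_pred p es)).
Proof.
  intros HP Hc Hes; apply within_bsubst.
  - apply within_exists_list with (A := pc_matrix p' c).
    apply within_Log_App2; split; [apply within_Log_App2; split|].
    + apply within_apps; [apply within_ren, within_pc_head; assumption|].
      apply hwithin_bound_vars.
    + apply within_apps_Cst, hwithin_ren, hwithin_bound_vars.
    + apply within_apps; [apply within_App|apply hwithin_bound_vars].
      * apply within_ren, within_pc_body; assumption.
      * apply conv_refl.
  - apply within_ext; [exact Hes|].
    apply member_cons_ind; [apply conv_refl|]. intros; apply conv_refl.
Qed.

Lemma within_translate V (es : hlist (term []) ts) :
  hwithin (vars_in V) es ->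
  Forall (within (vars_in V))
    (map (fun c => bsubst (pc_disjunct p' c) (inst_pred p es)) pcs).
Proof.
  intros Hes; apply Forall_forall; intros A [c [<- Hc]]%in_map_iff.
  apply within_pc_disjunct; auto using vars_in_admissible.
Qed.

Context (D0 : list (@clause S)).

(* The values [theta x] may mention variables outside the signature, which the
   right rule for the existential quantifier forbids; purging them changes neither
   [p es] nor the instance of the body up to conversion. *)
Lemma defRp_admissible_translate : defRp_admissible (translate p p' pcs :: D0) p pcs.
Proof.
  intros V Gamma es c xs theta Hok Hc _ _ Hnabs HP.
  assert (Hes : hwithin (vars_in V) es).
  { apply sequent_ok_within in Hok as (_ & H & _); apply within_atom in H; exact H. }
  (* The premise is derivable, hence its formula has no variable outside [V], and purging it stays
     within the conversion class. *)
  assert (HB : within (vars_in V) (fsubst theta (pc_inst p c (fvars xs)))).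
  { apply provable_sequent_ok, sequent_ok_within in HP; apply HP. }
  set (s := gcomp (gfs theta) (purge (vars_in V)) : gs [] []).
  set (rs := hmap (fun _ e => gsub e s) (fvars xs)).
  assert (Hclosed : forall t (e : @term S [] t), closed e -> conv (gsub e s) e).
  { intros t e He; unfold s; rewrite <- gsub_gsub, <- fsubst_gsub.
    eapply conv_trans; [apply conv_gsub, fsubst_closed, He|].
    apply conv_sym, fv_within; intros u x Hx; destruct (He u x Hx). }
  assert (Hrs : hwithin (vars_in V) rs).
  { apply hwithin_all; intros e He; apply fv_within; intros u x Hx.
    unfold rs, s in He; clear - He Hx.
    induction xs as [|v vs y xs IH]; simpl in He; [contradiction|].
    destruct He as [<-|He]; [|apply IH, He].
    exact (written_purge (vars_in_admissible V) (Hx _ (conv_refl _))). }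
  apply (p_defR (c := translate p p' pcs)); [exact Hok|left; reflexivity|].
  eapply provable_conv_right; [apply conv_sym, translate_unfold|].
  eapply provable_disj_list_right; [apply in_map, Hc|apply within_translate, Hes|].
  apply provable_exists_list_right with (A := pc_matrix p' c) (es := rs).
  { apply within_pc_disjunct; auto using vars_in_admissible. }
  { exact Hrs. }
  rewrite pc_matrix_inst.
  assert (HPs : provable (translate p p' pcs :: D0) V Gamma (pc_inst p c rs)).
  { eapply provable_conv_right; [|exact HP].
    eapply conv_trans; [exact HB|].
    rewrite fsubst_gsub, gsub_gsub; fold s; unfold pc_inst; rewrite gsub_apps.
    apply conv_apps; [|apply hconv_refl].
    apply conv_app; [|apply conv_refl].
    apply Hclosed, (Hpcs Hc). }
  assert (Hhead : nabs_holds (ts := pc_zs c) (apps (pc_head p c) rs) (apps (Cst p) es)).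
  { destruct Hnabs as (cs & Hcs & H); exists cs; split; [exact Hcs|].
    (* Both sides of the matching are purged: the left becomes the head at [rs], while the right
       keeps its conversion class because the variables of [p es] lie in [V]. *)
    apply conv_gsub with (s := purge (vars_in V)) in H.
    rewrite fsubst_gsub, gsub_gsub, gsub_apps in H; fold s in H.
    eapply conv_trans; [|eapply conv_trans; [exact H|]].
    - apply conv_apps; [|apply hconv_refl].
      apply conv_sym, Hclosed; intros u x Hx.
      refine (proj2 (fv_within (fun _ _ => False) _) _ u x Hx).
      apply within_pc_head; [apply vars_in_admissible|exact Hc].
    - apply conv_sym, within_abs_noms, within_atom, Hes. }
  pose proof (provable_sequent_ok HPs) as Hok'; rewrite sequent_ok_within in Hok'.
  assert (Hn : within (vars_in V)
    (nabs (ts := pc_zs c) (apps (pc_head p' c) rs) (apps (Cst p') es))).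
  { apply within_Log_App2; split; [|apply within_apps_Cst, Hes].
    apply within_apps; [|exact Hrs].
    apply within_pc_head; [apply vars_in_admissible|exact Hc]. }
  apply p_conjR; [| |exact HPs].
  - apply sequent_ok_within; split; [apply Hok'|split; [|apply Hok']].
    apply within_Log_App2; split; [exact Hn|apply Hok'].
  - apply p_nabsR.
    + apply sequent_ok_within; tauto.
    + assert (K := @nabs_holds_pc_head ts c rs es gid None p r p').
      rewrite !gsub_id in K; exact (K Hhead).
Qed.

(** Raising over the support of [p es] suits the existential quantifiers of every disjunct, because
    each disjunct has that same support: it contains [p' es], and the clause itself contributes no
    nominal constant. *)
Lemma defLp_admissible_translate : defLp_admissible (translate p p' pcs :: D0) p pcs.
Proof.
  intros V Gamma es C us cs Hok Hcs Hprem.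
  apply (p_defL (c := translate p p' pcs)); [exact Hok|left; reflexivity|].
  apply sequent_ok_cons in Hok as [Hes Hok]; apply within_atom in Hes.
  apply lists_supp_within in Hcs as (Hnd & Hin & Hout); apply within_atom in Hin.
  eapply provable_conv_left; [apply conv_sym, translate_unfold|].
  apply provable_disj_list_left; [exact Hok|].
  intros A [c [<- Hc]]%in_map_iff.
  destruct (Hprem c Hc) as (hs & Hhs & HV & HP); clear Hprem.
  apply provable_exists_list_left with (A := pc_matrix p' c) (cs := cs) (hs := hs);
    auto.
  - apply sequent_ok_cons; split; [|exact Hok].
    apply within_pc_disjunct; auto using vars_in_admissible.
  - apply within_pc_disjunct; auto using noms_in_admissible.
  (* Any instance of the matrix contains [es] as arguments of [p'], hence all of [cs]. *)
  - intros N rs; rewrite pc_matrix_inst.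
    intros [[_ H]%within_Log_App2 _]%within_Log_App2.
    apply Hout, within_atom; apply within_apps_Cst in H; exact H.
  - rewrite pc_matrix_inst.
    set (rs := raised cs hs) in *; set (V' := varset_union V (var_list hs)) in *.
    assert (Hok' : sequent_ok V' Gamma C) by (apply sequent_ok_union, Hok).
    assert (Hrs : hwithin (vars_in V') rs).
    { apply hwithin_raised; right; assumption. }
    assert (Wn : within (vars_in V')
      (nabs (ts := pc_zs c) (apps (pc_head p' c) rs) (apps (Cst p') es))).
    { apply within_nabs_head with (k := p), within_Log_App2; split.
      - apply within_apps; [|exact Hrs].
        apply within_pc_head; [apply vars_in_admissible|exact Hc].
      - apply within_vars_mono with (V := V); [left; assumption|].
        apply within_atom, Hes. }
    assert (Wb : within (vars_in V') (pc_inst p c rs)).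
    { apply within_apps; [apply within_App|exact Hrs]; [|apply conv_refl].
      apply within_pc_body; [apply vars_in_admissible|exact Hc]. }
    assert (Wc := proj2 (within_Log_App2 _ And _ _) (Logic.conj Wn Wb)).
    (* Both conjuncts are wanted on the left, so the conjunction is duplicated and each copy is
       projected. *)
    apply p_contr; [apply sequent_ok_cons; auto|].
    apply p_conjL1; [rewrite !sequent_ok_cons; auto|].
    eapply provable_perm; [reflexivity|apply perm_swap|].
    apply p_conjL2; [rewrite !sequent_ok_cons; auto|].
    eapply provable_perm; [reflexivity|apply perm_swap|].
    apply p_nabsL with (ts := pc_zs c); [rewrite !sequent_ok_cons; auto|].
    intros theta Hsol Gamma' C' HG HC'.
    (* The body was kept in the context of the nominal abstraction, so its image under [theta] is
       the formula [B'] that the premise of the pattern rule asks for. *)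
    inversion HG as [|? B' ? Gamma'' HB HG'']; subst.
    apply HP; auto.
    revert Hsol; apply solution_pc_head.
Qed.

End Clauses.
End Translation.

Theorem theorem4 (S : signature) (ts : list (typ S)) (r : option (base S))
  (p : @const S ts None) (p' : @const S ts r)
  (pcs : list (pclause ts)) (D0 : list (@clause S)) (lvl : @level_map S)
  (HD0 : definition_ok lvl D0)
  (HpD0 : ~ In (SCst p) (map (@cl_head S) D0))
  (Hpcs : pclauses_ok lvl p pcs)
  (Hp' : new_const D0 p p' pcs) :
  defRp_admissible (translate p p' pcs :: D0) p pcs /\
  defLp_admissible (translate p p' pcs :: D0) p pcs.
Proof.
  split; [eapply defRp_admissible_translate|eapply defLp_admissible_translate];
    exact Hpcs.
Qed.
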